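(* There is an algorithm for the min-max $r$-gathering problem on a tree such that, for any $\epsilon>0$, given an instance with user set $\mathcal{U}$ and facility set $\mathcal{F}$, it outputs a feasible solution whose cost is at most $(1+\epsilon)\,\mathrm{OPT}$, where $\mathrm{OPT}$ is the optimal cost of the instance, and it runs in $(|\mathcal{U}|+|\mathcal{F}|)^{O(1/\epsilon)}$ time.
   Context: A weighted tree $T=(V(T),E(T);l)$ has non-negative edge lengths $l:E(T)\to\mathbb{R}_{\ge 0}$; the tree metric $d(v,w)$ is the sum of the edge lengths on the unique $v$-$w$ path. In the min-max $r$-gathering problem on a tree, we are given a weighted tree, a positive integer $r$, a finite multiset $\mathcal{U}$ of users and a finite set $\mathcal{F}$ of facilities, each located at a vertex of the tree. A feasible solution opens a subset of the facilities and assigns every user to an open facility so that every open facility is assigned at least $r$ users. The cost of a solution is the maximum, over all users, of the distance between the user and its assigned facility; the goal is to minimize this cost. $\mathrm{OPT}$ denotes the minimum cost.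
   Formalization: The input also contains the table of pairwise tree distances between users and facilities, since |V(T)| is unbounded in |U|+|F| and distances could not be computed in the stated time; the time base is max(2,|U|+|F|); time is unit-cost real arithmetic. *)

(* Defs.v *)
(* MathComp / MathComp-Analysis *)
From HB Require Import structures.
From mathcomp Require Import all_boot all_order all_algebra.
From mathcomp Require Import all_classical all_reals all_analysis.

Set Implicit Arguments.
Unset Strict Implicit.
Unset Printing Implicit Defensive.

Import Order.TTheory GRing.Theory Num.Theory.
Import numFieldNormedType.Exports.

Local Open Scope ring_scope.

(** * Weighted trees *)

(* In a symmetric irreflexive graph, a graph-theoretic cycle is a [ucycle] with
   at least three vertices: the [ucycle]s of size at most 2 are the empty
   sequence and the back-and-forth along one edge. *)
Record wtree (R : realType) := WTree {
  nverts : nat;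
  adj : rel 'I_nverts;
  len : 'I_nverts -> 'I_nverts -> R;
  nverts_gt0 : (0 < nverts)%N;
  adj_sym : symmetric adj;
  adj_irr : irreflexive adj;
  adj_connected : forall v w, connect adj v w;
  adj_acyclic : forall c : seq 'I_nverts, ucycle adj c -> (size c <= 2)%N;
  len_sym : forall v w, adj v w -> len v w = len w v;
  len_ge0 : forall v w, adj v w -> 0 <= len v w }.

(* As in path.v, the vertices of the path are those of [v :: p]. *)
Definition is_simple_path (R : realType) (T : wtree R) (v w : 'I_(nverts T))
    (p : seq 'I_(nverts T)) : Prop :=
  [/\ path (@adj R T) v p, uniq (v :: p) & last v p = w].

Definition tree_path (R : realType) (T : wtree R) (v w : 'I_(nverts T)) :
    seq 'I_(nverts T) :=
  xget [::] [set p | is_simple_path v w p]%classic.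

Definition dist (R : realType) (T : wtree R) (v w : 'I_(nverts T)) : R :=
  let p := tree_path v w in \sum_(e <- zip (v :: p) p) len e.1 e.2.

(** * The min-max r-gathering problem on a tree *)

(* Users and facilities are indexed families, so that several of them may share
   a vertex. *)
Record instance (R : realType) := Instance {
  tree : wtree R;
  rmin : nat;
  rmin_gt0 : (0 < rmin)%N;
  nusers : nat;
  nfacs : nat;
  user : 'I_nusers -> 'I_(nverts tree);
  fac : 'I_nfacs -> 'I_(nverts tree) }.

Record solution (R : realType) (I : instance R) := Solution {
  opened : {set 'I_(nfacs I)};
  assign : {ffun 'I_(nusers I) -> 'I_(nfacs I)} }.

Definition feasible (R : realType) (I : instance R) (s : solution I) : Prop :=
  (forall u, assign s u \in opened s) /\
  (forall f, f \in opened s -> (rmin I <= #|[pred u | assign s u == f]|)%N).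

(* Distances are non-negative, so the default value 0 only matters when there
   is no user. *)
Definition cost (R : realType) (I : instance R) (s : solution I) : R :=
  \big[Num.max/0]_(u < nusers I) dist (user u) (fac (assign s u)).

Definition is_OPT (R : realType) (I : instance R) (opt : R) : Prop :=
  (exists s : solution I, feasible s /\ cost s = opt) /\
  (forall s : solution I, feasible s -> opt <= cost s).

(** * Algorithms

  A real-arithmetic machine in functional form: call-by-value first-order
  recursive programs over binary trees whose leaves are reals, where exact
  arithmetic, comparison, pairing, projection, variable access and function
  call have unit cost. There is no rounding operation; integers are represented
  by the corresponding reals. Values are immutable and shared, so passing,
  binding or pairing them amounts to copying pointers, and the model is
  polynomially equivalent to the real RAM. *)

Inductive value (R : Type) : Type :=
| VNum of R
| VNil
| VPair of value R & value R.
Arguments VNil {R}.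

Inductive arith : Set := Add | Sub | Mul | Div.

Inductive exp : Set :=
| EVar of nat                       (* de Bruijn index *)
| ELet of exp & exp
| ECst of nat
| EArith of arith & exp & exp
| EIfLe of exp & exp & exp & exp    (* if e1 <= e2 then e3 else e4 *)
| ENil
| EPair of exp & exp
| EFst of exp
| ESnd of exp
| EIfPair of exp & exp & exp        (* if e1 is a pair then e2 else e3 *)
| ECall of nat & exp.

(* A list of bodies of mutually recursive unary functions; function 0 is the
   entry point. No real number occurs in a program except the natural number
   constants. *)
Definition program : Set := seq exp.

Definition arith_fun (R : realType) (o : arith) : R -> R -> R :=
  match o with
  | Add => fun x y => x + y
  | Sub => fun x y => x - y
  | Mul => fun x y => x * y
  | Div => fun x y => x / y
  end.

Definition is_pair (R : Type) (v : value R) : bool :=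
  if v is VPair _ _ then true else false.

(* [evals p env e t v]: in environment [env], [e] evaluates to [v] in [t]
   steps. Ill-typed expressions have no value. *)
Inductive evals (R : realType) (p : program) :
    seq (value R) -> exp -> nat -> value R -> Prop :=
| eval_var env i : (i < size env)%N ->
    evals p env (EVar i) 1 (nth VNil env i)
| eval_let env e1 e2 t1 t2 v1 v2 :
    evals p env e1 t1 v1 -> evals p (v1 :: env) e2 t2 v2 ->
    evals p env (ELet e1 e2) (t1 + t2).+1 v2
| eval_cst env n : evals p env (ECst n) 1 (VNum n%:R)
| eval_arith env o e1 e2 t1 t2 x y :
    evals p env e1 t1 (VNum x) -> evals p env e2 t2 (VNum y) ->
    evals p env (EArith o e1 e2) (t1 + t2).+1 (VNum (arith_fun o x y))
| eval_ifle env e1 e2 e3 e4 t1 t2 t3 x y v :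
    evals p env e1 t1 (VNum x) -> evals p env e2 t2 (VNum y) ->
    evals p env (if x <= y then e3 else e4) t3 v ->
    evals p env (EIfLe e1 e2 e3 e4) (t1 + t2 + t3).+1 v
| eval_nil env : evals p env ENil 1 VNil
| eval_pair env e1 e2 t1 t2 v1 v2 :
    evals p env e1 t1 v1 -> evals p env e2 t2 v2 ->
    evals p env (EPair e1 e2) (t1 + t2).+1 (VPair v1 v2)
| eval_fst env e t v1 v2 :
    evals p env e t (VPair v1 v2) -> evals p env (EFst e) t.+1 v1
| eval_snd env e t v1 v2 :
    evals p env e t (VPair v1 v2) -> evals p env (ESnd e) t.+1 v2
| eval_ifpair env e1 e2 e3 t1 t2 v1 v :
    evals p env e1 t1 v1 ->
    evals p env (if is_pair v1 then e2 else e3) t2 v ->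
    evals p env (EIfPair e1 e2 e3) (t1 + t2).+1 v
| eval_call env f e t1 t2 v1 v : (f < size p)%N ->
    evals p env e t1 v1 -> evals p [:: v1] (nth ENil p f) t2 v ->
    evals p env (ECall f e) (t1 + t2).+1 v.

Definition runs (R : realType) (p : program) (input : value R) (t : nat)
    (output : value R) : Prop :=
  evals p [:: input] (ECall 0 (EVar 0)) t output.

(** * Encoding of inputs and outputs *)

Definition vnat (R : realType) (n : nat) : value R := VNum n%:R.

Definition vlist (R : realType) (s : seq (value R)) : value R :=
  foldr (@VPair R) VNil s.

Definition venc_edges (R : realType) (T : wtree R) : value R :=
  let E := [set e : 'I_(nverts T) * 'I_(nverts T)
           | adj e.1 e.2 && (e.1 < e.2)%N] in
  vlist [seq vlist [:: vnat R e.1; vnat R e.2; VNum (len e.1 e.2)]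
        | e : 'I_(nverts T) * 'I_(nverts T) <- enum E].

Definition sites (R : realType) (I : instance R) : seq 'I_(nverts (tree I)) :=
  [seq user u | u <- enum 'I_(nusers I)] ++
  [seq fac f | f <- enum 'I_(nfacs I)].

(* The distances between located points (users, then facilities) accompany the
   edge list: the number of vertices of the tree is not bounded in terms of the
   number of users and facilities, so no sequential algorithm could compute
   even one such distance from the edges within a time bound depending on the
   latter number alone. *)
Definition venc_dists (R : realType) (I : instance R) : value R :=
  vlist [seq vlist [seq VNum (dist v w) | w <- sites I] | v <- sites I].

Definition venc_input (R : realType) (eps : R) (I : instance R) : value R :=
  vlist [:: VNum eps; vnat R (rmin I);
            vnat R (nverts (tree I)); venc_edges (tree I);
            vlist [seq vnat R (user u) | u <- enum 'I_(nusers I)];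
            vlist [seq vnat R (fac f) | f <- enum 'I_(nfacs I)];
            venc_dists I].

Definition venc_solution (R : realType) (I : instance R) (s : solution I) :
    value R :=
  VPair (vlist [seq vnat R f | f : 'I_(nfacs I) <- enum (opened s)])
        (vlist [seq vnat R (assign s u) | u <- enum 'I_(nusers I)]).

(* Main.v *)
Require Import Defs.
From HB Require Import structures.
From mathcomp Require Import all_boot all_order all_algebra.
From mathcomp Require Import all_classical all_reals all_analysis.
From mathcomp Require Import zify ring lra.
Import Order.TTheory GRing.Theory Num.Theory.
Import numFieldNormedType.Exports.
Local Open Scope classical_set_scope.
Local Open Scope ring_scope.

(* Guess the optimum b among the distances between sites and set
   delta = eps b / 4.  Rooting the tree at a site, a user u and a facility f
   meeting at a vertex of depth s are at distance D u + D f - 2 s, where D is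
   the depth; by the four-point condition the depths of the meeting points form
   an ultrametric, so the sites split recursively into two clusters such that
   all pairs across the split meet at the same depth.

   A facility that is opened creates a number k >= r of slots, and the users
   have to be matched perfectly with the slots.  A bottom-up dynamic program
   over the clusters keeps partial matchings, one for each possible number of
   unmatched users and slots at each depth.  Depths are snapped to values that
   are more than delta apart, once and for all, so that errors do not accumulate
   and a matched pair is off by at most 4 delta.  The unmatched users and slots
   of a cluster whose pairs meet at depth at least s lie, up to delta, between
   the depths s and s + b, hence have O(1/eps) different snapped depths, and
   there are at most N ^ O(1/eps) partial matchings to be kept. *)

Set Implicit Arguments.
Unset Strict Implicit.
Unset Printing Implicit Defensive.

(** * Distances in a tree *)

(** The obstacle is the lower bound r: users cannot simply go to their nearest open facility, and
    whether a facility may open depends on users far outside its cluster. Fixing the number of slots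
    where a facility enters the recursion turns r into a local choice; what remains is a perfect
    matching all of whose pairs must be short. Across a split [gp] has one value s, so whether a
    pending user and a pending slot may be matched there depends on their depths alone. Two states
    with the same multisets of snapped depths are therefore interchangeable, and one representative
    is kept. The matching test compares the sum of the snapped depths with s + b + 2 delta, which
    admits every pair across the split at distance at most b. Undoing the snapping at both ends adds
    2 delta, so an accepted pair is within b + 4 delta = (1 + eps) b. The window of pending depths
    has length b + 2 delta = (4 / eps + 2) delta, whence O(1 / eps) values. *)

Section TreeMetric.
Variables (R : realType) (T : wtree R).
Local Notation V := 'I_(nverts T).
Local Notation adj := (@adj R T).
Implicit Types (v w x y : V) (p q c : seq V).

Definition walk_len v p : R := \sum_(e <- zip (v :: p) p) len e.1 e.2.

Lemma walk_len_cons v x p : walk_len v (x :: p) = len v x + walk_len x p.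
Proof. by rewrite /walk_len /= big_cons. Qed.

Lemma walk_len_cat v p q :
  walk_len v (p ++ q) = walk_len v p + walk_len (last v p) q.
Proof.
elim: p v => [|x p IH] v /=; first by rewrite [in RHS]/walk_len big_nil add0r.
by rewrite !walk_len_cons IH addrA.
Qed.

Lemma walk_len_ge0 v p : path adj v p -> 0 <= walk_len v p.
Proof.
elim: p v => [|x p IH] v /=; first by rewrite /walk_len big_nil.
by case/andP=> a_vx px; rewrite walk_len_cons addr_ge0 ?IH ?len_ge0.
Qed.

Lemma walk_len_rev v p : path adj v p ->
  walk_len (last v p) (rev (belast v p)) = walk_len v p.
Proof.
elim: p v => [|x p IH] v //= /andP[a_vx px].
rewrite rev_cons -cats1 walk_len_cat IH // walk_len_cons.
have -> : last (last x p) (rev (belast x p)) = x.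
  by case: p {IH px} => //= y p; rewrite rev_cons last_rcons.
by rewrite walk_len_cons [walk_len v [::]]big_nil addr0 addrC len_sym // adj_sym.
Qed.

Lemma rev_walk v p : path adj v p -> path adj (last v p) (rev (belast v p)).
Proof. by rewrite rev_path (eq_path (e' := adj)) // => a b; rewrite adj_sym. Qed.

Lemma last_rev_belast v p : last (last v p) (rev (belast v p)) = v.
Proof. by case: p => //= y p; rewrite rev_cons last_rcons. Qed.

(** If the walks left v through different neighbours a and b, following p from a and returning along
    q to b would avoid v. Made simple and closed through v, this would be a cycle with at least
    three vertices. *)
Lemma uniq_walk v p q : path adj v p -> uniq (v :: p) -> path adj v q ->
  uniq (v :: q) -> last v p = last v q -> p = q.
Proof.
elim: p v q => [|a p IH] v [|b q] //.
- by move=> _ _ _ /= /andP[/negP vq _] v_q; case: vq; rewrite v_q mem_last.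
- by move=> _ /= /andP[/negP vq _] _ _ v_q; case: vq; rewrite -v_q mem_last.
move=> /= /andP[va pa] /andP[vp up] /andP[vb pb] /andP[vq uq] e_last.
have [eab|nab] := eqVneq a b.
  by subst b; rewrite (IH a q).
pose s := p ++ rev (belast b q).
have ps : path adj a s by rewrite cat_path pa e_last rev_walk.
have ls : last a s = b by rewrite last_cat e_last last_rev_belast.
have vs : v \notin a :: s.
  rewrite /s -cat_cons mem_cat negb_or vp mem_rev.
  by apply: contra vq; exact: mem_belast.
move: ls; case: (shortenP ps) => s' ps' us' ss' ls'.
have := @adj_acyclic R T [:: v, a & s'].
rewrite /ucycle /= va rcons_path ps' ls' adj_sym vb /=.
have -> : v \notin a :: s'.
  apply: contra vs; rewrite !inE => /orP[->//|/ss' ->]; exact: orbT.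
move=> /(_ us'); case: s' ls' {ps' us' ss'} => //= e_ab.
by rewrite e_ab eqxx in nab.
Qed.

Lemma tree_pathP v w : is_simple_path v w (tree_path v w).
Proof.
have /connectP[p pp ->] := adj_connected v w.
case: (shortenP pp) => p' pp' up' _.
apply: (@xgetPex _ _ [set q | is_simple_path v (last v p') q]).
by exists p'.
Qed.

Lemma dist_walk v p : path adj v p -> uniq (v :: p) ->
  dist v (last v p) = walk_len v p.
Proof.
move=> pp up; have [pq uq lq] := tree_pathP v (last v p).
by rewrite /dist -(uniq_walk pp up pq uq).
Qed.

Lemma dist_ge0 v w : 0 <= dist v w.
Proof. by have [pq _ _] := tree_pathP v w; exact: walk_len_ge0. Qed.

Lemma dist0 v : dist v v = 0.
Proof. by rewrite (@dist_walk v [::]) //= /walk_len big_nil. Qed.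

Lemma dist_fork v p q : path adj v p -> uniq (v :: p) -> path adj v q ->
  uniq (v :: q) -> ~~ has (mem p) q ->
  dist (last v p) (last v q) = walk_len v p + walk_len v q.
Proof.
move=> pp up pq uq dpq.
have := @dist_walk (last v p) (rev (belast v p) ++ q).
rewrite last_cat last_rev_belast cat_path rev_walk // last_rev_belast pq.
rewrite walk_len_cat last_rev_belast walk_len_rev // => -> //.
rewrite -cat_cons -rev_rcons -lastI cat_uniq rev_uniq up.
have : v \notin q /\ uniq q by apply/andP.
case=> vq ->; rewrite andbT.
apply/hasPn => z zq; rewrite /= mem_rev inE negb_or (hasPn dpq z zq) andbT.
by apply: contraNneq vq => <-.
Qed.

Lemma distC v w : dist v w = dist w v.
Proof.
have [pq uq lq] := tree_pathP v w.
have := dist_fork (q := [::]) pq uq isT isT isT.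
by rewrite lq /= [walk_len v [::]]big_nil addr0 -dist_walk // lq.
Qed.

(** For two paths from a root, the longest common prefix ends at the meeting point of their
    endpoints. *)
Fixpoint lcp (p q : seq V) : seq V :=
  if p is x :: p' then
    if q is y :: q' then if x == y then x :: lcp p' q' else [::] else [::]
  else [::].

Lemma lcp_prefixl p q : prefix (lcp p q) p.
Proof. by elim: p q => //= x p IH [|y q] //; case: eqP => //= _; rewrite eqxx IH. Qed.

Lemma lcpC p q : lcp p q = lcp q p.
Proof.
elim: p q => [|x p IH] [|y q] //=.
by rewrite eq_sym; case: eqP => // ->; rewrite IH.
Qed.

Lemma prefix_lcp c p q : prefix c p -> prefix c q -> prefix c (lcp p q).
Proof.
elim: c p q => [|z c IH] [|x p] [|y q] //=; rewrite ?prefix0s //.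
case/andP=> /eqP <- cp /andP[/eqP <- cq].
by rewrite eqxx /= eqxx IH.
Qed.

Lemma dist_lcp v p q : path adj v p -> uniq (v :: p) -> path adj v q ->
  uniq (v :: q) -> dist (last v p) (last v q) =
    walk_len v p + walk_len v q - walk_len v (lcp p q) *+ 2.
Proof.
elim: p v q => [|x p IH] v q; first move=> _ _ pq uq.
  by rewrite /= [walk_len v [::]]big_nil mul0rn add0r subr0 -dist_walk.
case: q => [|y q].
  move=> pp up _ _.
  by rewrite /= [walk_len v [::]]big_nil mul0rn addr0 subr0 distC -dist_walk.
move=> pp up pq uq; rewrite /lcp -/lcp.
have [exy|nxy] := eqVneq x y.
  subst y; move: pp up pq uq => /= /andP[_ pp] /andP[_ up] /andP[_ pq] /andP[_ uq].
  by rewrite IH // !walk_len_cons !mulr2n; ring.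
rewrite [walk_len v [::]]big_nil mul0rn subr0 dist_fork //.
(* A common vertex z would be reached from v by two simple paths with different first steps x and y,
   against [uniq_walk]. *)
apply/hasPn => z zq; apply/negP => zp.
have [p1 [p2 ep]] : exists p1 p2, x :: p = rcons p1 z ++ p2.
  by case/splitPr: zp => p1 p2; exists p1, p2; rewrite cat_rcons.
have [q1 [q2 eq]] : exists q1 q2, y :: q = rcons q1 z ++ q2.
  by case/splitPr: zq => q1 q2; exists q1, q2; rewrite cat_rcons.
move: pp up pq uq; rewrite ep eq -!cat_cons !cat_path !cat_uniq.
move=> /andP[pp _] /and3P[up _ _] /andP[pq _] /and3P[uq _ _].
have e1 : rcons p1 z = rcons q1 z by apply: (@uniq_walk v); rewrite ?last_rcons.
move: ep eq; rewrite e1; case: (q1) => [|t q3] [ex _] [ey _];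
  by rewrite ex ey eqxx in nxy.
Qed.

Lemma dist_tree_lcp v x y :
  dist x y = dist v x + dist v y -
    walk_len v (lcp (tree_path v x) (tree_path v y)) *+ 2.
Proof.
have [px ux lx] := tree_pathP v x; have [py uy ly] := tree_pathP v y.
by rewrite -{1}lx -{1}ly dist_lcp.
Qed.

Lemma prefix_path v p q : prefix p q -> path adj v q -> path adj v p.
Proof. by case/prefixP => s ->; rewrite cat_path => /andP[]. Qed.

Lemma walk_len_prefix v p q : path adj v q -> prefix p q ->
  walk_len v p <= walk_len v q.
Proof.
move=> pq /prefixP[s e]; move: pq; rewrite e cat_path => /andP[_ ps].
by rewrite walk_len_cat lerDl walk_len_ge0.
Qed.

Lemma dist_triangle v x y : dist x y <= dist x v + dist v y.
Proof.
rewrite (dist_tree_lcp v) [dist x v]distC lerBlDr lerDl mulrn_wge0 //.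
have [px _ _] := tree_pathP v x.
exact/walk_len_ge0/(prefix_path (lcp_prefixl _ _)).
Qed.

(** Each of the three terms is twice the length of a common prefix of two root paths. The prefixes
    shared with y are both prefixes of the path to y, hence comparable, and the shorter one is
    common to the paths to x and z. *)
Lemma dist_four_point v x y z :
  Num.min (dist v x + dist v y - dist x y) (dist v y + dist v z - dist y z)
    <= dist v x + dist v z - dist x z.
Proof.
rewrite !(dist_tree_lcp v x) (dist_tree_lcp v y z) !subKr.
have [px _ _] := tree_pathP v x; have [py _ _] := tree_pathP v y.
set cxy := lcp _ _; set cyz := lcp _ _; set cxz := lcp _ _.
have pcx : prefix cxy (tree_path v x) by exact: lcp_prefixl.
have pcy : prefix cxy (tree_path v y) by rewrite /cxy lcpC lcp_prefixl.
have pdy : prefix cyz (tree_path v y) by exact: lcp_prefixl.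
have pdz : prefix cyz (tree_path v z) by rewrite /cyz lcpC lcp_prefixl.
have pz : path adj v cxz := prefix_path (lcp_prefixl _ _) px.
have pre c d (s : seq V) : prefix c s -> prefix d s ->
    (size c <= size d)%N -> prefix c d.
  rewrite [prefix c s]prefixE [prefix d s]prefixE => /eqP ec /eqP ed le_cd.
  by rewrite prefixE -ed take_takel // ec.
rewrite ge_min !lerMn2r /=.
have [le|/ltnW le] := leqP (size cxy) (size cyz).
  rewrite walk_len_prefix // prefix_lcp //.
  exact: prefix_trans (pre _ _ _ pcy pdy le) pdz.
rewrite [X in _ || X]walk_len_prefix ?orbT // prefix_lcp //.
exact: prefix_trans (pre _ _ _ pdy pcy le) pcx.
Qed.
End TreeMetric.

(** * The dynamic program *)

Lemma foldl_inv (A : eqType) (B : Type) (P : B -> Prop) (F : B -> A -> B) l z :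
  P z -> (forall x y, x \in l -> P y -> P (F y x)) -> P (foldl F z l).
Proof.
elim: l z => //= x l IH z Pz PF; apply: IH.
  by apply: PF; rewrite ?mem_head.
by move=> y w yl; apply: PF; rewrite inE yl orbT.
Qed.

(** Used for tables: a covered state stays covered, so it is enough that one element of the loop
    adds it. *)
Lemma foldl_hit (A : eqType) (B : Type) (C : B -> Prop) (F : B -> A -> B) l z x :
  x \in l -> (forall w y, C w -> C (F w y)) -> (forall w, C (F w x)) ->
  C (foldl F z l).
Proof.
move=> xl mono hit; elim: l z xl => //= y l IH z.
rewrite inE => /orP[/eqP <-|/IH//].
by apply: foldl_inv => // u w _; exact: mono.
Qed.

(** The hypothesis counts the occurrences of x on either side. This balances the pending tokens of
    two clusters against the matched ones and those of the union. *)
Lemma perm_filter4 (T : eqType) (P1 P2 P3 P4 : pred T) s :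
  (forall x, x \in s -> P1 x + P2 x = P3 x + P4 x)%N ->
  perm_eq ([seq x <- s | P1 x] ++ [seq x <- s | P2 x])
    ([seq x <- s | P3 x] ++ [seq x <- s | P4 x]).
Proof.
move=> eP; apply/permP => a; rewrite !count_cat !count_filter.
elim: s eP => //= x s IH eP.
have := eP x (mem_head _ _); have := IH (fun y ys => eP y (mem_behead (s := x :: s) ys)).
case: (a x) (P1 x) (P2 x) (P3 x) (P4 x) => [] [] [] [] [] /=; lia.
Qed.

Lemma size_words (B k : nat) (L : seq (seq nat)) :
  uniq L -> (forall s, s \in L -> size s = k /\ all (ltn^~ B) s) ->
  (size L <= B ^ k)%N.
Proof.
move=> uL wL.
pose E := map (fun t : k.-tuple 'I_B => map val t) (enum {: k.-tuple 'I_B}).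
have -> : (B ^ k = size E)%N by rewrite size_map -cardE card_tuple card_ord.
apply: uniq_leq_size => // s /wL[sk aB].
have [t et] : exists t : k.-tuple 'I_B, map val t = s.
  elim: s k sk aB {uL wL E} => [|x s IH] k.
    by case: k => //= _ _; exists [tuple].
  case: k => //= k [/IH {}IH] /andP[xB /IH[t et]].
  by exists [tuple of Ordinal xB :: t]; rewrite /= et.
by apply/mapP; exists t; rewrite ?mem_enum.
Qed.

Lemma size_separated (R : realType) (l : seq R) (lo dlt : R) (k : nat) :
  0 <= dlt -> uniq l ->
  (forall x, x \in l -> lo <= x <= lo + k%:R * dlt) ->
  (forall x y, x \in l -> y \in l -> x != y -> dlt < `|x - y|) ->
  (size l <= k.+1)%N.
Proof.
move=> dlt0 ul wl sl.
(* The guess b = 0 gives delta = 0, and the interval is a point. Otherwise each of the k + 1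
   half-open cells of width [dlt] holds at most one value. *)
have [dz|dn0] := eqVneq dlt 0.
  case: l ul wl sl => [|x [|y l]] //= /andP[]; rewrite inE negb_or.
  move=> /andP[/negP nxy _] _ wl _.
  have := wl x (mem_head _ _); have : y \in [:: x, y & l] by rewrite !inE eqxx orbT.
  move=> /wl; rewrite dz mulr0 addr0 => /andP[? ?] /andP[? ?].
  by case: nxy; apply/eqP; lra.
have dp : 0 < dlt by rewrite lt_neqAle eq_sym dn0.
pose g x := Num.truncn ((x - lo) / dlt).
have gP x : x \in l -> (g x)%:R <= (x - lo) / dlt < (g x).+1%:R.
  move=> /wl/andP[lox _]; apply: truncn_itv; rewrite divr_ge0 //; lra.
have ug : uniq (map g l).
  rewrite map_inj_in_uniq // => x y xl yl exy.
  apply/eqP; apply: contraT => /(sl _ _ xl yl).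
  have := gP _ xl; have := gP _ yl; rewrite exy.
  rewrite !ler_pdivlMr // !ltr_pdivrMr // -natr1.
  move=> /andP[? ?] /andP[? ?].
  have [le|lt] := leP 0 (x - y); [rewrite ger0_norm //|rewrite ltr0_norm //];
   nra.
rewrite -(size_map g) -(size_iota 0 k.+1).
apply: uniq_leq_size => // i /mapP[x xl ->].
rewrite mem_iota add0n /= ltnS.
have /andP[_ xk] := wl _ xl; have /andP[gx _] := gP _ xl.
rewrite -(ler_nat R) (le_trans gx) // ler_pdivrMr //; lra.
Qed.

Definition find_done (T : seq (seq nat * seq nat * seq (nat * nat))) :=
  foldl (fun a p => if nilp p.1.1 then if nilp p.1.2 then Some p.2 else a else a)
    None T.

Lemma find_doneP T mt : find_done T = Some mt -> ([::], [::], mt) \in T.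
Proof.
suff h (a : option (seq (nat * nat))) :
    foldl (fun a p => if nilp p.1.1 then if nilp p.1.2 then Some p.2 else a else a)
      a T = Some mt -> a = Some mt \/ (([::], [::], mt) : seq nat * seq nat * _) \in T.
  by case/h.
elim: T a => [|[[pu ps] m] T IH] a /=; first by left.
case: pu => [|u pu] /=; [case: ps => [|f ps] /=|] => /IH[]; auto;
  try by move=> mtT; right; rewrite inE mtT orbT.
by case=> ->; right; rewrite inE eqxx.
Qed.

Lemma find_done_neq0 T p : p \in T -> nilp p.1.1 -> nilp p.1.2 -> find_done T != None.
Proof.
move=> pT pu ps; apply: (@foldl_hit _ _ (fun a => a != None) _ _ _ _ pT).
  by move=> a y; case: ifP => // _; case: ifP.
by move=> a; rewrite pu ps.
Qed.

(** * The algorithm on an abstract tree metric *)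

Section Gathering.
Variables (R : realType) (N n r : nat) (d : nat -> nat -> R) (b dlt : R).

Definition root_dist i := d i 0%N.
Local Notation D := root_dist.

(* Twice the Gromov product of the sites i and j at the root, site 0: twice the
   depth of their meeting point. *)
Definition gp i j := D i + D j - d i j.

(** The machine has no rounding to multiples of [dlt]; a greedy net of the depths needs only
    comparisons. A depth far from all earlier values becomes a new value. *)
Definition snap x (l : seq R) :=
  foldl (fun res c => if x <= c + dlt then if c <= x + dlt then c else res
                      else res) x l.

Fixpoint snaps k := if k is k'.+1 then snap (D k') (snaps k') :: snaps k' else [::].

Definition Dt i := snap (D i) (snaps i).

(* Pending users, pending slots of opened facilities, matched pairs. *)
Definition state := (seq nat * seq nat * seq (nat * nat))%type.

Definition sig_eq (p q : state) :=
  perm_eq (map Dt p.1.1) (map Dt q.1.1) && perm_eq (map Dt p.1.2) (map Dt q.1.2).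

Definition insert p T := if has (sig_eq p) T then T else p :: T.

(** The start value is [gp x x], an upper bound of every [gp x y]. *)
Definition min_gp x l :=
  foldl (fun m y => if gp x y <= m then gp x y else m) (D x + D x) l.

(* All pairs across the two parts have the same [gp], namely the minimum of
   [gp] on the cluster [x :: l] when s is [min_gp x l]. *)
Definition split x s l :=
  foldl (fun AB y => if gp x y <= s then (AB.1, y :: AB.2) else (y :: AB.1, AB.2))
    ([:: x], [::]) l.

(* The facility i is closed, or opened with any number of slots from r to k. *)
Fixpoint fac_table i k : seq state :=
  if k is k'.+1 then
    if (r <= k)%N then ([::], nseq k i, [::]) :: fac_table i k'
    else fac_table i k'
  else [:: ([::], [::], [::])].

Definition single i : seq state :=
  if (n <= i)%N then fac_table i N else [:: ([:: i], [::], [::])].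

(** A pending token must still meet its partner at or above the current split, so one lying too deep
    can never be matched. Discarding such states is what bounds the window of snapped depths from
    above. *)
Definition shallow lim (l : seq nat) := all (fun j => Dt j + Dt j <= lim) l.
Definition st_shallow lim (p : state) := shallow lim p.1.1 && shallow lim p.1.2.

Definition app (p q : state) : state :=
  (catrev p.1.1 q.1.1, catrev p.1.2 q.1.2, catrev p.2 q.2).

Definition merge1 lim TB T p : seq state :=
  foldl (fun T q => if st_shallow lim (app p q) then insert (app p q) T else T)
    T TB.

Definition merge lim TA TB : seq state := foldl (merge1 lim TB) [::] TA.

Definition pair_up (p : state) u f : state :=
  (rem u p.1.1, rem f p.1.2, (u, f) :: p.2).

Definition match_slots M p T u : seq state :=
  foldl (fun T f => if Dt u + Dt f <= M then insert (pair_up p u f) T else T)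
    T p.1.2.

Definition match_users M T p : seq state := foldl (match_slots M p) T p.1.1.

(** T is both the list of states to extend by one pair and the initial accumulator, so states with
    fewer matched pairs survive. *)
Definition match_step M T : seq state := foldl (match_users M) T T.

(** Reversed because [snaps] and the list built by the program grow at the head. It also serves as a
    counter for N rounds, since loops run over lists. *)
Definition all_sites := rev (iota 0 N).

Definition match_all M T : seq state := foldl (fun T _ => match_step M T) T all_sites.

(** k is fuel, at least the size of S. Here s is twice the depth of the split, and the limit for
    pending tokens is also on the doubled scale, which is why b enters it twice. *)
Fixpoint solve k S : seq state :=
  if k is k'.+1 then
    if S is x :: l then
      if l is [::] then single x else
      let s := min_gp x l in
      let AB := split x s l in
      match_all (s + (b + dlt + dlt))
        (merge (s + (b + dlt + dlt) + b) (solve k' AB.1) (solve k' AB.2))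
    else [::]
  else [::].

Hypothesis b_ge0 : 0 <= b.
Hypothesis dlt_ge0 : 0 <= dlt.
Hypothesis r_gt0 : (0 < r)%N.
Hypothesis n_le_N : (n <= N)%N.
Hypothesis dxx : forall i, d i i = 0.
Hypothesis dC : forall i j, d i j = d j i.
Hypothesis d_triangle : forall k i j, d i j <= d i k + d k j.
Hypothesis gp_ultra : forall i j k, Num.min (gp i j) (gp j k) <= gp i k.

(** * Snapped depths and signatures *)

Lemma snapP x l :
  (snap x l \in l /\ (x <= snap x l + dlt /\ snap x l <= x + dlt)) \/
  (snap x l = x /\ forall c, c \in l -> dlt < `|x - c|).
Proof.
rewrite /snap; elim/last_ind: l => [|l c IH]; first by right.
rewrite -cats1 foldl_cat /=.
have far : ~ (x <= c + dlt /\ c <= x + dlt) -> dlt < `|x - c|.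
  move=> h; rewrite ltNge ler_norml; apply/negP => /andP[? ?]; apply: h; lra.
case: ifPn => [h1|/negP h1].
  case: ifPn => [h2|/negP h2]; first by left; rewrite mem_cat mem_seq1 eqxx orbT.
  have fc : dlt < `|x - c| by apply: far => -[].
  case: IH => [[? ?]|[e h]]; [left|right]; rewrite ?mem_cat; split=> //.
    by apply/orP; left.
  by move=> y; rewrite mem_cat mem_seq1 => /orP[/h//|/eqP->].
have fc : dlt < `|x - c| by apply: far => -[].
case: IH => [[? ?]|[e h]]; [left|right]; rewrite ?mem_cat; split=> //.
  by apply/orP; left.
by move=> y; rewrite mem_cat mem_seq1 => /orP[/h//|/eqP->].
Qed.

Lemma DtP i : D i <= Dt i + dlt /\ Dt i <= D i + dlt.
Proof.
rewrite /Dt; have [[_ //]|[-> _]] := snapP (D i) (snaps i); have := dlt_ge0; split; lra.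
Qed.

Lemma snaps_Dt i k : (i < k)%N -> Dt i \in snaps k.
Proof.
elim: k => //= k IH; rewrite ltnS leq_eqVlt inE => /orP[/eqP <-|/IH->].
  by rewrite /Dt eqxx.
by rewrite orbT.
Qed.

Lemma snapsE k : snaps k = map Dt (rev (iota 0 k)).
Proof. by elim: k => // k IH; rewrite -[in RHS]addn1 iotaD rev_cat /= -IH. Qed.

Lemma DtE i : Dt i = snap (D i) (map Dt (rev (iota 0 i))).
Proof. by rewrite -snapsE. Qed.

Lemma snaps_sep k x y : x \in snaps k -> y \in snaps k -> x != y -> dlt < `|x - y|.
Proof.
elim: k x y => //= k IH.
have h y : y \in snaps k -> snap (D k) (snaps k) != y ->
    dlt < `|snap (D k) (snaps k) - y|.
  have [[sk _] yk|[-> far] /far //] := snapP (D k) (snaps k); exact: IH.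
move=> x y; rewrite !inE => /orP[/eqP->|xk] /orP[/eqP->|yk] //.
- by rewrite eqxx.
- exact: h.
- by rewrite distrC eq_sym; apply: h.
- exact: IH.
Qed.

Lemma Dt_sep i j : Dt i != Dt j -> dlt < `|Dt i - Dt j|.
Proof.
by apply: (@snaps_sep (maxn i j).+1); apply: snaps_Dt; rewrite ltnS ?leq_maxl ?leq_maxr.
Qed.

Lemma gpC i j : gp i j = gp j i.
Proof. by rewrite /gp dC [D i + _]addrC. Qed.

Lemma gp_le2 i j : gp i j <= D i + D i.
Proof. by rewrite /gp /root_dist; have := d_triangle i j 0%N; rewrite (dC j i); lra. Qed.

Lemma gpxx i : gp i i = D i + D i.
Proof. by rewrite /gp dxx subr0. Qed.

Lemma gp_via i j k s : s <= gp i j -> s <= gp j k -> s <= gp i k.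
Proof. by move=> h1 h2; apply: le_trans (gp_ultra i j k); rewrite le_min h1 h2. Qed.

Lemma sig_eq_refl p : sig_eq p p.
Proof. by rewrite /sig_eq !perm_refl. Qed.

Lemma sig_eq_sym p q : sig_eq p q = sig_eq q p.
Proof. by rewrite /sig_eq perm_sym [perm_eq (map _ p.1.2) _]perm_sym. Qed.

Lemma sig_eq_trans q p s : sig_eq p q -> sig_eq q s -> sig_eq p s.
Proof.
by move=> /andP[h1 h2] /andP[h3 h4]; rewrite /sig_eq (perm_trans h1) ?(perm_trans h2).
Qed.

Definition covers (T : seq state) q := has (sig_eq q) T.

Lemma covers_sig T p q : sig_eq p q -> covers T p -> covers T q.
Proof.
move=> epq /hasP[t tT ept]; apply/hasP; exists t => //.
by apply: sig_eq_trans ept; rewrite sig_eq_sym.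
Qed.

Lemma covers_insert p T q : covers T q -> covers (insert p T) q.
Proof. by rewrite /insert; case: ifP => //= _ h; apply/orP; right. Qed.

Lemma insert_covers p T : covers (insert p T) p.
Proof. by rewrite /insert; case: ifP => //= _; rewrite /covers /= sig_eq_refl. Qed.

Lemma covers_if (c : bool) p T q :
  covers T q -> covers (if c then insert p T else T) q.
Proof. by case: c => //; exact: covers_insert. Qed.

(** * Soundness and size of the tables *)

Definition table_inv (P : state -> Prop) (T : seq state) :=
  (forall p, p \in T -> P p) /\ pairwise (fun p q => ~~ sig_eq p q) T.

Lemma table_inv_insert P p T : P p -> table_inv P T -> table_inv P (insert p T).
Proof.
move=> Pp [PT dT]; rewrite /insert; case: ifPn => // nT; split.
  by move=> q; rewrite inE => /orP[/eqP->|/PT].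
by rewrite /= dT andbT all_predC.
Qed.

(** Clusters are balls of the ultrametric given by the depths of meeting points. *)
Definition cluster S :=
  [/\ uniq S, (forall i, i \in S -> (i < N)%N) &
    forall x y x' x'', x \in S -> (y < N)%N -> y \notin S ->
      x' \in S -> x'' \in S -> gp x y <= gp x' x''].

(** Pending and matched tokens are counted together, so matching a pair affects only the distance
    clause. A facility has at most N slots, whence the last clause. *)
Definition wf_state S (p : state) :=
  [/\ perm_eq (p.1.1 ++ map fst p.2) [seq i <- S | (i < n)%N],
      (forall f, f \in p.1.2 ++ map snd p.2 -> f \in S /\ (n <= f)%N),
      (forall f, count_mem f (p.1.2 ++ map snd p.2) = 0%N \/
                 (r <= count_mem f (p.1.2 ++ map snd p.2))%N),
      (forall m, m \in p.2 -> d m.1 m.2 <= b + dlt + dlt + dlt + dlt) &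
      (size (p.1.2 ++ map snd p.2) <= N * size S)%N].

Lemma wf_perm S S' p : perm_eq S S' -> wf_state S p -> wf_state S' p.
Proof.
move=> eS [h1 h2 h3 h4 h5]; split=> //.
- by rewrite (perm_trans h1) // perm_filter.
- by move=> f /h2; rewrite (perm_mem eS).
- by rewrite -(perm_size eS).
Qed.

Lemma perm_catrev (T : eqType) (s1 s2 : seq T) : perm_eq (catrev s1 s2) (s1 ++ s2).
Proof. by rewrite catrevE perm_cat2r perm_rev. Qed.

Lemma app_perm (p q : state) (T : eqType) (g : nat -> T) (h : nat * nat -> T)
    (s1 s2 : seq nat) :
  perm_eq (map g (catrev s1 s2) ++ map h (catrev p.2 q.2))
    ((map g s1 ++ map h p.2) ++ (map g s2 ++ map h q.2)).
Proof.
apply/permP => a; rewrite !count_cat !count_map.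
by rewrite !(permP (perm_catrev _ _)) !count_cat addnACA.
Qed.

Lemma app_wf A B p q :
  wf_state A p -> wf_state B q -> wf_state (A ++ B) (app p q).
Proof.
case=> [h1 h2 h3 h4 h5] [k1 k2 k3 k4 k5].
have pu := app_perm p q id fst p.1.1 q.1.1.
have ps := app_perm p q id snd p.1.2 q.1.2.
rewrite !map_id in pu ps.
split=> /=.
- by rewrite (perm_trans pu) // filter_cat perm_cat.
- move=> f; rewrite (perm_mem ps) mem_cat => /orP[/h2[fA ?]|/k2[fB ?]];
  by rewrite mem_cat ?fA ?fB ?orbT.
- move=> f; rewrite (permP ps) count_cat.
  case: (h3 f) (k3 f) => [->|le] [->|le']; rewrite ?addn0 ?add0n; auto.
  by right; apply: leq_trans (leq_addr _ _).
- move=> m; rewrite (perm_mem (perm_catrev _ _)) mem_cat => /orP[/h4|/k4] //.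
- by rewrite (perm_size ps) size_cat [size (A ++ B)]size_cat mulnDr leq_add.
Qed.

(** The test does not know on which sides of the split u and f lie. It is sound anyway: [gp u f] is
    at least s inside the cluster, so a pair on one side is only closer than the test assumes. *)
Lemma pair_wf S s p u f : (forall x y, x \in S -> y \in S -> s <= gp x y) ->
  wf_state S p -> u \in p.1.1 -> f \in p.1.2 ->
  Dt u + Dt f <= s + (b + dlt + dlt) -> wf_state S (pair_up p u f).
Proof.
move=> gpS [h1 h2 h3 h4 h5] up fp le.
have pu : perm_eq (rem u p.1.1 ++ u :: map fst p.2) (p.1.1 ++ map fst p.2).
  rewrite -cat_rcons perm_cat2r perm_rcons perm_sym; exact: perm_to_rem.
have ps : perm_eq (rem f p.1.2 ++ f :: map snd p.2) (p.1.2 ++ map snd p.2).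
  rewrite -cat_rcons perm_cat2r perm_rcons perm_sym; exact: perm_to_rem.
split=> /=.
- exact: perm_trans h1.
- by move=> g; rewrite (perm_mem ps) => /h2.
- by move=> g; rewrite (permP ps).
- move=> m; rewrite inE => /orP[/eqP->/=|/h4] //.
  have uS : u \in S.
    have : u \in [seq i <- S | (i < n)%N] by rewrite -(perm_mem h1) mem_cat up.
    by rewrite mem_filter => /andP[].
  have [fS _] : f \in S /\ (n <= f)%N by apply: h2; rewrite mem_cat fp.
  have := gpS _ _ uS fS; rewrite /gp.
  by have [? ?] := DtP u; have [? ?] := DtP f; lra.
- by rewrite (perm_size ps).
Qed.

Definition node_inv S lim p := wf_state S p /\ st_shallow lim p.

Lemma shallow_rem lim x l : shallow lim l -> shallow lim (rem x l).
Proof. by move=> /allP h; apply/allP => y /mem_rem /h. Qed.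

Lemma merge1_inv A B lim TB T p :
  wf_state A p -> (forall q, q \in TB -> wf_state B q) ->
  table_inv (node_inv (A ++ B) lim) T ->
  table_inv (node_inv (A ++ B) lim) (merge1 lim TB T p).
Proof.
set P := node_inv _ _ => pA hB iT.
apply: (@foldl_inv _ _ (table_inv P)) => // q {iT}T qB iT.
case: ifP => // ok; apply: table_inv_insert => //; split=> //.
exact: app_wf pA (hB _ qB).
Qed.

Lemma merge_inv A B lim TA TB :
  (forall p, p \in TA -> wf_state A p) -> (forall p, p \in TB -> wf_state B p) ->
  table_inv (node_inv (A ++ B) lim) (merge lim TA TB).
Proof.
set P := node_inv _ _ => hA hB.
apply: (@foldl_inv _ _ (table_inv P)) => // p T pA iT.
by apply: merge1_inv => //; exact: hA.
Qed.

Section MatchInvariant.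
Variables (S : seq nat) (lim s : R).
Hypothesis gpS : forall x y, x \in S -> y \in S -> s <= gp x y.
Local Notation M := (s + (b + dlt + dlt)).
Local Notation good := (table_inv (node_inv S lim)).

Lemma pair_inv p u f : node_inv S lim p -> u \in p.1.1 -> f \in p.1.2 ->
  Dt u + Dt f <= M -> node_inv S lim (pair_up p u f).
Proof.
move=> [wp /andP[ok1 ok2]] up fp le; split; first exact: pair_wf gpS wp up fp le.
by rewrite /st_shallow !shallow_rem.
Qed.

Lemma match_slots_inv p u T : node_inv S lim p -> u \in p.1.1 -> good T ->
  good (match_slots M p T u).
Proof.
move=> ip up gT; apply: (@foldl_inv _ _ good) => // f {gT}T fp gT.
by case: ifP => // le; apply: table_inv_insert => //; exact: pair_inv.
Qed.

Lemma match_users_inv p T : node_inv S lim p -> good T -> good (match_users M T p).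
Proof.
move=> ip gT; apply: (@foldl_inv _ _ good) => // u {gT}T up gT.
exact: match_slots_inv.
Qed.

Lemma match_step_inv T : good T -> good (match_step M T).
Proof.
move=> gT; apply: (@foldl_inv _ _ good) => // p T1 pT gT1.
by apply: match_users_inv => //; exact: gT.1.
Qed.

Lemma match_all_inv T : good T -> good (match_all M T).
Proof.
by move=> gT; apply: (@foldl_inv _ _ good) => // x T1 _; exact: match_step_inv.
Qed.
End MatchInvariant.

(* Unmatched tokens have snapped depths in an interval of length b + 2 delta,
   which contains at most K + 1 such values, and the states of a table are
   determined by two counters for each of these values. *)
Lemma node_size S s K T : (forall i, i \in S -> (i < N)%N) -> (size S <= N)%N ->
  (forall x y, x \in S -> y \in S -> s <= gp x y) ->
  b + dlt + dlt <= K%:R * dlt ->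
  table_inv (node_inv S (s + (b + dlt + dlt) + b)) T ->
  (size T <= (N * N).+1 ^ (K.+1 + K.+1))%N.
Proof.
set lim := _ + b => SN sS hS hK [iT dT].
pose W := undup [seq Dt j | j <- S & Dt j + Dt j <= lim].
have sW : (size W <= K.+1)%N.
  (* The depth of a site of S is half of [gp j j], hence at least s / 2, and snapping lowers it by
     at most [dlt]. Shallowness gives the upper end s / 2 + b + dlt. *)
  apply: (@size_separated _ _ (s / 2 - dlt) dlt) => //.
  - exact: undup_uniq.
  - move=> x; rewrite mem_undup => /mapP[j]; rewrite mem_filter => /andP[jl jS] ->.
    have := hS j j jS jS; rewrite gpxx => ?; have [? ?] := DtP j.
    move: jl; rewrite /lim => ?; apply/andP; split; lra.
  - move=> x y; rewrite !mem_undup => /mapP[i _ ->] /mapP[j _ ->]; exact: Dt_sep.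
have inW p l : node_inv S lim p -> l = p.1.1 \/ l = p.1.2 ->
    all (mem W) (map Dt l) /\ (size l <= N * N)%N.
  case=> -[w1 w2 _ _ w5] /andP[ok1 ok2] el.
  have lS j : j \in l -> j \in S /\ Dt j + Dt j <= lim.
    case: el => -> jl; split; [|exact: (allP ok1)| |exact: (allP ok2)].
      have : j \in [seq i <- S | (i < n)%N] by rewrite -(perm_mem w1) mem_cat jl.
      by rewrite mem_filter => /andP[].
    by case: (w2 j); rewrite ?mem_cat ?jl.
  split.
    apply/allP => x /mapP[j /lS[jS jl] ->] /=.
    by rewrite mem_undup; apply: map_f; rewrite mem_filter jl.
  case: el => ->.
    apply: (@leq_trans (size (p.1.1 ++ map fst p.2))); first by rewrite size_cat leq_addr.
    rewrite (perm_size w1) size_filter (leq_trans (count_size _ _)) //.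
    by rewrite (leq_trans sS) //; case: (N) => // k; rewrite leq_pmulr.
  apply: (@leq_trans (size (p.1.2 ++ map snd p.2))); first by rewrite size_cat leq_addr.
  by rewrite (leq_trans w5) // leq_mul2l sS orbT.
pose word (p : state) := [seq count_mem c (map Dt p.1.1) | c <- W] ++
                         [seq count_mem c (map Dt p.1.2) | c <- W].
rewrite -(size_map word).
apply: (@leq_trans ((N * N).+1 ^ (size W + size W))%N); last first.
  by rewrite leq_pexp2l // leq_add.
apply: size_words.
  rewrite uniq_pairwise pairwise_map.
  apply: (sub_in_pairwise (P := mem T)) dT; last exact/allP.
  move=> p q /iT ip /iT iq; apply: contraNneq => /eqP.
  rewrite /word eqseq_cat ?size_map // => /andP[/eqP/eq_in_map e1 /eqP/eq_in_map e2].
  by apply/andP; split; apply/allP => x; rewrite mem_cat => /orP[] xl /=; apply/eqP;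
    [apply: e1|apply: e1|apply: e2|apply: e2]; move: xl; apply/allP;
    [case: (inW p p.1.1)|case: (inW q q.1.1)|case: (inW p p.1.2)|case: (inW q q.1.2)];
    auto.
move=> w /mapP[p /iT ip ->]; rewrite size_cat !size_map; split=> //.
have [_ z1] := inW p _ ip (or_introl erefl).
have [_ z2] := inW p _ ip (or_intror erefl).
by rewrite all_cat; apply/andP; split; apply/allP => x /mapP[c _ ->];
  rewrite /= ltnS (leq_trans (count_size _ _)) ?size_map.
Qed.

Lemma min_gpP x l : l != [::] ->
  (forall y, y \in l -> min_gp x l <= gp x y) /\
  (min_gp x l <= D x + D x /\ exists2 y, y \in l & gp x y = min_gp x l).
Proof.
move=> l0.
have [h1 h2 h3] : [/\ forall y, y \in l -> min_gp x l <= gp x y,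
    min_gp x l <= D x + D x &
    min_gp x l = D x + D x \/ exists2 y, y \in l & gp x y = min_gp x l].
  elim/last_ind: l {l0} => [|l y]; first by split; [| |left].
  rewrite /min_gp -cats1 foldl_cat /= => -[h1 h2 h3].
  case: ifPn => [le|]; [|rewrite -ltNge => /ltW le]; split=> //.
  - move=> z; rewrite mem_cat mem_seq1 => /orP[/h1|/eqP->] //; exact: le_trans.
  - exact: le_trans h2.
  - by right; exists y; rewrite // mem_cat mem_seq1 eqxx orbT.
  - by move=> z; rewrite mem_cat mem_seq1 => /orP[/h1|/eqP->].
  - by case: h3 => [|[z zl e]]; [left|right; exists z; rewrite // mem_cat zl].
split=> //; split=> //; case: h3 => // e.
case: l l0 h1 e {h2} => // y l _ h1 e; exists y; first exact: mem_head.
by apply/eqP; rewrite eq_le h1 ?mem_head // e gp_le2.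
Qed.

Lemma splitE x s l : split x s l =
  (rcons (rev [seq y <- l | ~~ (gp x y <= s)]) x, rev [seq y <- l | gp x y <= s]).
Proof.
rewrite -cats1 -catrevE -(cats0 (rev [seq y <- l | gp x y <= s])) -catrevE /split.
move: [:: x] => A; move: [::] => B.
by elim: l A B => //= y l IH A B; case: (gp x y <= s) => /=; rewrite IH.
Qed.

Lemma cluster_size S : cluster S -> (size S <= N)%N.
Proof.
case=> uS SN _; rewrite -(size_iota 0 N); apply: uniq_leq_size => // i /SN.
by rewrite mem_iota.
Qed.

(** Comparing through x gives [gp] at least s inside the cluster. If i in A and j in B had [gp]
    above s, then so would x and j by way of i, contradicting that j is in B. For j outside the
    cluster the bound is the cluster property, as s is attained inside. *)
Lemma split_cluster x l (s : R := min_gp x l)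
    (A := (split x s l).1) (B := (split x s l).2) :
  l != [::] -> cluster (x :: l) ->
  [/\ perm_eq (A ++ B) (x :: l), cluster A, cluster B,
      (0 < size A)%N & (0 < size B)%N] /\
  ((forall i j, i \in x :: l -> j \in x :: l -> s <= gp i j) /\
   (forall i j, (j < N)%N ->
     (i \in A) && (j \notin A) || (i \in B) && (j \notin B) -> gp i j <= s)).
Proof.
rewrite /A /B splitE /= => l0.
set A' := rcons _ _; set B' := rev _ => -[uS SN hS].
have [m1 [m2 [z zl ez]]] := min_gpP x l0.
rewrite -/s in m1 m2 ez.
have pAB : perm_eq (A' ++ B') (x :: l).
  rewrite cat_rcons perm_catC /= perm_cons -rev_cat perm_rev.
  by rewrite perm_catC; apply: permEl; exact: perm_filterC.
have sx j : j \in x :: l -> s <= gp x j.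
  by rewrite inE => /orP[/eqP->|/m1 //]; rewrite gpxx.
have sS i j : i \in x :: l -> j \in x :: l -> s <= gp i j.
  by move=> iS jS; apply: (@gp_via _ x); [rewrite gpC|]; exact: sx.
have zB : z \in B' by rewrite mem_rev mem_filter ez lexx.
have cross i j : i \in A' -> j \in B' -> gp i j <= s.
  rewrite mem_rcons inE !mem_rev !mem_filter => ih /andP[jB jl].
  case/orP: ih => [/eqP->//|/andP[]]; rewrite -ltNge => iA il.
  rewrite leNgt; apply/negP => lt.
  have : s < gp x j.
    by apply: lt_le_trans (gp_ultra x i j); rewrite lt_min iA lt.
  by rewrite ltNge jB.
have AS i : i \in A' -> i \in x :: l by rewrite -(perm_mem pAB) mem_cat => ->.
have BS i : i \in B' -> i \in x :: l by rewrite -(perm_mem pAB) mem_cat orbC => ->.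
have := perm_uniq pAB; rewrite uS cat_uniq => /and3P[uA _ uB].
have out i j : (j < N)%N ->
    (i \in A') && (j \notin A') || (i \in B') && (j \notin B') -> gp i j <= s.
  move=> jN h; have [jS|jS] := boolP (j \in x :: l); last first.
    rewrite -ez; apply: hS => //; [|exact: mem_head|by rewrite inE zl orbT].
    by case/orP: h => /andP[? _]; [exact: AS|exact: BS].
  move: jS; rewrite -(perm_mem pAB) mem_cat.
  case/orP: h => /andP[iI /negPf->]; rewrite ?orbF /= => jJ; first exact: cross.
  by rewrite gpC; exact: cross.
do ![split=> //].
- by move=> i /AS/SN.
- move=> i j i' i'' iA jN jA i'A i''A.
  apply: (@le_trans _ _ s); last by apply: sS; exact: AS.
  by apply: out; rewrite // iA jA.
- by move=> i /BS/SN.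
- move=> i j i' i'' iB jN jB i'B i''B.
  apply: (@le_trans _ _ s); last by apply: sS; exact: BS.
  by apply: out; rewrite // iB jB orbT.
- by rewrite size_rcons.
- by case: (B') zB.
Qed.

Lemma fac_tableP i k p : p \in fac_table i k ->
  exists j, [/\ p = ([::], nseq j i, [::]), (j <= k)%N & j = 0%N \/ (r <= j)%N].
Proof.
elim: k => [|k IH] /=; first by rewrite inE => /eqP->; exists 0%N; split; auto.
case: ifP => [rk|_].
  rewrite inE => /orP[/eqP->|]; first by exists k.+1; split; auto.
  by move=> /IH[j [-> jk ?]]; exists j; rewrite (leq_trans jk).
by move=> /IH[j [-> jk ?]]; exists j; rewrite (leq_trans jk).
Qed.

Lemma mem_fac_table i k j : (j <= k)%N -> j = 0%N \/ (r <= j)%N ->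
  (([::], nseq j i, [::]) : state) \in fac_table i k.
Proof.
elim: k => [|k IH] jk hj; first by move: jk; rewrite leqn0 => /eqP->; rewrite inE.
have [ejk|njk] := eqVneq j k.+1.
  by case: hj => [h|rj]; [rewrite h in ejk|rewrite ejk /= -ejk rj inE eqxx].
by rewrite /=; case: ifP => _; rewrite ?inE IH ?orbT //; lia.
Qed.

Lemma size_fac_table i k : (size (fac_table i k) <= k.+1)%N.
Proof. by elim: k => //= k IH; case: ifP => _ /=; rewrite ?ltnS // (leq_trans IH). Qed.

Lemma single_wf i p : (i < N)%N -> p \in single i -> wf_state [:: i] p.
Proof.
move=> iN; rewrite /single; case: leqP => ni.
  case/fac_tableP => j [-> jN hj]; split=> //=; rewrite ?cats0 ?ltnNge ?ni //.
  - by move=> f; rewrite mem_nseq inE => /andP[_ /eqP->]; rewrite eqxx.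
  - by move=> f; rewrite count_nseq /=; case: (i == f); rewrite ?mul1n; auto.
  - by rewrite size_nseq muln1.
by rewrite inE => /eqP->; split=> //=; rewrite ?ni //; left.
Qed.

Lemma size_single i : (size (single i) <= N.+1)%N.
Proof. by rewrite /single; case: ifP => _; rewrite ?size_fac_table. Qed.

(** The size bound does not deteriorate along the recursion: at each node it comes afresh from
    [node_size], not from the sizes of the two subtables. *)
Lemma solve_inv K k S : b + dlt + dlt <= K%:R * dlt ->
  cluster S -> (0 < size S <= k)%N ->
  (forall p, p \in solve k S -> wf_state S p) /\
  (size (solve k S) <= (N * N).+1 ^ (K.+1 + K.+1))%N.
Proof.
move=> hK; elim: k S => [|k IH] S; first by case: S.
case: S => // x [|y l] cS /= sk.
  have [_ SN _] := cS; split=> [p|].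
    by apply: single_wf; apply: SN; rewrite inE.
  apply: leq_trans (size_single x) _.
  rewrite addSn expnS -[X in (X <= _)%N]muln1 leq_mul ?expn_gt0 // ltnS.
  by case: (N) => // m; rewrite leq_pmulr.
have [[pAB cA cB A0 B0] [hin hcross]] := split_cluster (isT : y :: l != [::]) cS.
set s := min_gp x (y :: l) in pAB cA cB A0 B0 hin hcross *.
set A := (split _ _ _).1 in pAB cA A0 hcross *.
set B := (split _ _ _).2 in pAB cB B0 hcross *.
have /= sAB := perm_size pAB; rewrite size_cat in sAB.
have sk' : (size A + size B <= k.+1)%N by rewrite sAB.
have [wA _] : (forall p, p \in solve k A -> wf_state A p) /\
    (size (solve k A) <= (N * N).+1 ^ (K.+1 + K.+1))%N.
  by apply: IH => //; rewrite A0 -ltnS (leq_trans _ sk') // -addn1 leq_add2l.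
have [wB _] : (forall p, p \in solve k B -> wf_state B p) /\
    (size (solve k B) <= (N * N).+1 ^ (K.+1 + K.+1))%N.
  by apply: IH => //; rewrite B0 -ltnS (leq_trans _ sk') // -add1n leq_add2r.
have inv0 := merge_inv (s + (b + dlt + dlt) + b) wA wB.
have hin' i j : i \in A ++ B -> j \in A ++ B -> s <= gp i j.
  by rewrite !(perm_mem pAB); exact: hin.
have inv := match_all_inv hin' inv0; split.
  by move=> p /inv.1[+ _]; apply: wf_perm.
apply: node_size hin' hK inv.
  by case: cS => _ SN _ i; rewrite (perm_mem pAB); apply: SN.
by rewrite (perm_size pAB) cluster_size.
Qed.

(** * Completeness: the tables follow any feasible assignment of cost at most b *)

Section Completeness.
Variable tgt : nat -> nat.
Hypothesis tgt_fac : forall u, (u < n)%N -> (n <= tgt u < N)%N.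
Hypothesis tgt_near : forall u, (u < n)%N -> d u (tgt u) <= b.
Hypothesis tgt_load : forall f,
  count (fun u => tgt u == f) (iota 0 n) = 0%N \/
  (r <= count (fun u => tgt u == f) (iota 0 n))%N.

Definition users (P : pred nat) := [seq u <- iota 0 n | P u].

(* The pending tokens of the target assignment at the cluster S. *)
Definition target (S : seq nat) : state :=
  (users (fun u => (u \in S) && (tgt u \notin S)),
   map tgt (users (fun u => (u \notin S) && (tgt u \in S))), [::]).

Lemma users0 P : (forall u, (u < n)%N -> ~~ P u) -> users P = [::].
Proof.
move=> h; rewrite /users -(filter_pred0 (iota 0 n)); apply: eq_in_filter => u.
by rewrite mem_iota add0n => /h/negPf.
Qed.

Lemma eq_users P Q : (forall u, (u < n)%N -> P u = Q u) -> users P = users Q.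
Proof. by move=> h; apply: eq_in_filter => u; rewrite mem_iota add0n => /h. Qed.

(** The right number of slots is the number of users sent to i, which is 0 or at least r by
    [tgt_load], and at most n. *)
Lemma single_covers i : (i < N)%N -> covers (single i) (target [:: i]).
Proof.
move=> iN; rewrite /single /target; case: leqP => ni.
  rewrite users0; last first.
    by move=> u un; rewrite inE; have -> : (u == i) = false by apply/eqP; lia.
  rewrite (@eq_users _ (fun u => tgt u == i)); last first.
    by move=> u un; rewrite !inE; have -> : (u == i) = false by apply/eqP; lia.
  set c := count (fun u => tgt u == i) (iota 0 n).
  have -> : map tgt (users (fun u => tgt u == i)) = nseq c i.
    rewrite /c -size_filter -/(users _) -(size_map tgt).
    apply/all_pred1P/allP => x /mapP[u]; rewrite mem_filter => /andP[/eqP <- _] ->.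
    by rewrite /= eqxx.
  apply/hasP; exists ([::], nseq c i, [::]); last exact: sig_eq_refl.
  apply: mem_fac_table; last exact: tgt_load.
  by rewrite (leq_trans (count_size _ _)) // size_iota.
rewrite [users (fun u => (u \notin _) && _)]users0; last first.
  move=> u /tgt_fac/andP[h _]; rewrite !inE.
  have -> : (tgt u == i) = false by apply/eqP; lia.
  by rewrite andbF.
rewrite (@eq_users _ (pred1 i)); last first.
  move=> u /tgt_fac/andP[h _]; rewrite !inE.
  have -> : (tgt u == i) = false by apply/eqP; lia.
  by rewrite andbT.
rewrite /users filter_pred1_uniq ?iota_uniq ?mem_iota //.
by rewrite /covers /= sig_eq_refl.
Qed.

(** The partner of a pending token lies no higher than their meeting point, and that point has
    doubled depth at most s. So the token is at most b below it, plus [dlt] for snapping. *)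
Lemma target_shallow A s :
  (forall i j, i \in A -> (j < N)%N -> j \notin A -> gp i j <= s) ->
  (forall i, i \in A -> (i < N)%N) ->
  st_shallow (s + (b + dlt + dlt) + b) (target A).
Proof.
move=> h hN; apply/andP; split; apply/allP => x /=.
  rewrite mem_filter mem_iota add0n => /andP[/andP[xA fA] xn].
  have /andP[_ fN] := tgt_fac xn; have := h _ _ xA fN fA.
  have := tgt_near xn; have := gp_le2 (tgt x) x; rewrite gpC.
  have [? ?] := DtP x; rewrite /gp; lra.
move=> /mapP[u]; rewrite mem_filter mem_iota add0n => /andP[/andP[uA fA] un] ->.
have := h _ _ fA (leq_trans un n_le_N) uA.
have := tgt_near un; have := gp_le2 u (tgt u); rewrite [gp (tgt u) u]gpC.
have [? ?] := DtP (tgt u); rewrite /gp; lra.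
Qed.

Lemma shallow_perm lim l l' : perm_eq (map Dt l) (map Dt l') ->
  shallow lim l = shallow lim l'.
Proof.
move=> e; have := perm_all (fun x : R => x + x <= lim) e.
by rewrite !all_map.
Qed.

Lemma app_sig p q p' q' : sig_eq p p' -> sig_eq q q' -> sig_eq (app p q) (app p' q').
Proof.
move=> /andP[h1 h2] /andP[k1 k2]; rewrite /sig_eq /app /=.
have pc s1 s2 : perm_eq (map Dt (catrev s1 s2)) (map Dt s1 ++ map Dt s2).
  by rewrite -map_cat perm_map // perm_catrev.
rewrite !(permPl (pc _ _)) ![perm_eq (_ ++ _) _]perm_sym !(permPl (pc _ _)).
by rewrite !perm_cat // perm_sym.
Qed.

(** Representatives can stand for p and q because shallowness and the signature of a union depend
    only on signatures. *)
Lemma merge_covers lim TA TB p q : covers TA p -> covers TB q ->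
  st_shallow lim p -> st_shallow lim q -> covers (merge lim TA TB) (app p q).
Proof.
move=> /hasP[p' pA ep] /hasP[q' qB eq] okp okq.
have ok : st_shallow lim (app p' q').
  have sh l l' : shallow lim (catrev l l') = shallow lim l && shallow lim l'.
    by rewrite /shallow (perm_all _ (perm_catrev _ _)) all_cat.
  move: ep eq okp okq => /andP[/shallow_perm e1 /shallow_perm e2].
  move=> /andP[/shallow_perm e3 /shallow_perm e4].
  rewrite /st_shallow /= !sh !e1 !e2 !e3 !e4.
  by move=> /andP[-> ->] /andP[-> ->].
set C := fun T => covers T (app p' q').
suff h : C (merge lim TA TB).
  by apply: covers_sig h; rewrite sig_eq_sym; exact: app_sig.
apply: (@foldl_hit _ _ C _ _ _ _ pA).
  move=> T x h; apply: (@foldl_inv _ _ C) => // y {h}T _; exact: covers_if.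
move=> T; apply: (@foldl_hit _ _ C _ _ _ _ qB); first by move=> {}T y; exact: covers_if.
by move=> {}T; rewrite ok; exact: insert_covers.
Qed.

Lemma match_step_mono M T p : covers T p -> covers (match_step M T) p.
Proof.
set C := fun T => covers T p => h.
apply: (@foldl_inv _ _ C) => // x {h}T _ h.
apply: (@foldl_inv _ _ C) => // y {h}T _ h.
apply: (@foldl_inv _ _ C) => // z {h}T _ h; exact: covers_if.
Qed.

Lemma sig_eq_pair_up P Q m m' p u f u' f' : sig_eq (u :: P, f :: Q, m) p ->
  u' \in p.1.1 -> f' \in p.1.2 -> Dt u' = Dt u -> Dt f' = Dt f ->
  sig_eq (P, Q, m') (pair_up p u' f').
Proof.
rewrite /sig_eq /= => /andP[h1 h2] up fp eu ef.
have h (x y : nat) s s' : perm_eq (Dt x :: map Dt s) (map Dt s') -> y \in s' ->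
    Dt y = Dt x -> perm_eq (map Dt s) (map Dt (rem y s')).
  move=> e ys exy; rewrite -(perm_cons (Dt y)) -[_ :: map _ (rem _ _)]map_cons.
  rewrite exy (perm_trans e) //; apply: perm_map; exact: perm_to_rem.
by rewrite (h u u') ?(h f f').
Qed.

(** An exchange: the representative need not contain u and f, but it has tokens with the same
    snapped depths, and the test reads nothing else. *)
Lemma match_step_covers M T u f P Q : Dt u + Dt f <= M ->
  covers T (u :: P, f :: Q, [::]) -> covers (match_step M T) (P, Q, [::]).
Proof.
move=> le /hasP[p pT ep].
have [u' up eu] : exists2 u', u' \in p.1.1 & Dt u' = Dt u.
  have /andP[/perm_mem/(_ (Dt u))] := ep.
  by rewrite mem_head => /esym/mapP[u' ? ?]; exists u'.
have [f' fp ef] : exists2 f', f' \in p.1.2 & Dt f' = Dt f.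
  have /andP[_ /perm_mem/(_ (Dt f))] := ep.
  by rewrite mem_head => /esym/mapP[f' ? ?]; exists f'.
set q := pair_up p u' f'; set C := fun T => covers T q.
suff h : C (match_step M T).
  apply: covers_sig h; rewrite sig_eq_sym; exact: sig_eq_pair_up ep _ _ _ _.
apply: (@foldl_hit _ _ C _ _ _ _ pT).
  move=> {ep pT}T x h; apply: (@foldl_inv _ _ C) => // y {h}T _ h.
  apply: (@foldl_inv _ _ C) => // z {h}T _ h; exact: covers_if.
move=> {pT}T; apply: (@foldl_hit _ _ C _ _ _ _ up).
  move=> {}T y h; apply: (@foldl_inv _ _ C) => // z {h}T _ h; exact: covers_if.
move=> {}T; apply: (@foldl_hit _ _ C _ _ _ _ fp).
  by move=> {}T y; exact: covers_if.
by move=> {}T; rewrite eu ef le; exact: insert_covers.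
Qed.

(* [match_all] makes N rounds, of which the first [size X] match the users X. *)
Lemma match_all_covers M T P Q (X : seq nat) : (size X <= N)%N ->
  (forall u, u \in X -> Dt u + Dt (tgt u) <= M) ->
  covers T (X ++ P, map tgt X ++ Q, [::]) -> covers (match_all M T) (P, Q, [::]).
Proof.
have -> : N = size all_sites by rewrite size_rev size_iota.
rewrite /match_all; elim: all_sites X T => [|x l IH] [|u X] T //= sX hX h.
  apply: (IH [::]) => //=; exact: match_step_mono.
apply: (IH X) => //; first by move=> y yX; apply: hX; rewrite inE yX orbT.
by apply: match_step_covers h; apply: hX; rewrite mem_head.
Qed.

(** The users X matched at this node are those whose target lies across the split. The remaining
    pending tokens of the two parts are exactly those of S. *)
Lemma solve_covers k S : cluster S -> (0 < size S <= k)%N ->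
  covers (solve k S) (target S).
Proof.
elim: k S => [|k IH] S; first by case: S.
case: S => // x [|y l] cS /= sk.
  have [_ SN _] := cS; apply: single_covers; apply: SN; exact: mem_head.
have [[pAB cA cB A0 B0] [hin hout]] := split_cluster (isT : y :: l != [::]) cS.
set s := min_gp x (y :: l) in pAB cA cB A0 B0 hin hout *.
set A := (split _ _ _).1 in pAB cA A0 hout *.
set B := (split _ _ _).2 in pAB cB B0 hout *.
have sk' : (size A + size B <= k.+1)%N by rewrite -size_cat (perm_size pAB).
have hA : covers (solve k A) (target A).
  by apply: IH => //; rewrite A0 -ltnS (leq_trans _ sk') // -addn1 leq_add2l.
have hB : covers (solve k B) (target B).
  by apply: IH => //; rewrite B0 -ltnS (leq_trans _ sk') // -add1n leq_add2r.
have [_ AN _] := cA; have [_ BN _] := cB.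
have shA : st_shallow (s + (b + dlt + dlt) + b) (target A).
  by apply: target_shallow => // i j iA jN jA; apply: hout => //; rewrite iA jA.
have shB : st_shallow (s + (b + dlt + dlt) + b) (target B).
  by apply: target_shallow => // i j iB jN jB; apply: hout; rewrite // iB jB orbT.
have h := merge_covers hA hB shA shB.
pose X := users (fun u => (u \in A) && (tgt u \in B) || (u \in B) && (tgt u \in A)).
have disj i : ~~ ((i \in A) && (i \in B)).
  have [uS _ _] := cS; have := perm_uniq pAB; rewrite uS cat_uniq.
  by move=> /and3P[_ /hasPn nB _]; apply/negP => /andP[iA /nB/negP]; apply.
have SAB i : (i \in [:: x, y & l]) = (i \in A) || (i \in B).
  by rewrite -(perm_mem pAB) mem_cat.
apply: (@match_all_covers _ _ _ _ X).
- by rewrite (leq_trans _ n_le_N) // size_filter (leq_trans (count_size _ _)) ?size_iota.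
- move=> u; rewrite mem_filter mem_iota add0n => /andP[uX un].
  have /andP[_ fN] := tgt_fac un.
  have : gp u (tgt u) <= s.
    apply: hout => //; move: uX (disj (tgt u)).
    by case: (u \in A) (u \in B) (tgt u \in A) (tgt u \in B) => [] [] [] [].
  have := tgt_near un; rewrite /gp; have [? ?] := DtP u; have [? ?] := DtP (tgt u).
  lra.
apply: covers_sig h; rewrite /sig_eq /=.
have pc (s1 s2 : seq nat) s3 : perm_eq (s1 ++ s2) s3 ->
    perm_eq (map Dt (catrev s1 s2)) (map Dt s3).
  by move=> e; apply: perm_map; rewrite (permPl (perm_catrev _ _)).
apply/andP; split; apply: pc.
  apply: perm_filter4 => u _; rewrite !SAB; move: (disj u) (disj (tgt u)).
  by case: (u \in A) (u \in B) (tgt u \in A) (tgt u \in B) => [] [] [] [].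
rewrite -!map_cat; apply: perm_map.
apply: perm_filter4 => u _; rewrite !SAB; move: (disj u) (disj (tgt u)).
by case: (u \in A) (u \in B) (tgt u \in A) (tgt u \in B) => [] [] [] [].
Qed.

(** For the set of all sites nothing in the target is pending, and equal signatures have equal
    sizes. *)
Lemma solve_done k : cluster all_sites -> (0 < size all_sites <= k)%N ->
  find_done (solve k all_sites) != None.
Proof.
have sitesE i : (i \in all_sites) = (i < N)%N by rewrite mem_rev mem_iota.
move=> cS sk; have /hasP[p pT] := solve_covers cS sk.
rewrite /target !users0 //; last first.
- by move=> u /tgt_fac/andP[_ h]; rewrite !sitesE h andbF.
- by move=> u un; rewrite sitesE (leq_trans un n_le_N).
move=> /andP[/perm_size e1 /perm_size e2]; rewrite !size_map in e1 e2.
by apply: find_done_neq0 pT _ _; rewrite /nilp -?e1 -?e2.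
Qed.
End Completeness.
End Gathering.

(** * Evaluation with time bounds *)

Definition EIfEq a c e1 e2 := EIfLe a c (EIfLe c a e1 e2) e2.

Definition ETrue := EPair ENil ENil.

Section Evaluation.
Variables (R : realType) (p : program).
Implicit Types (env : seq (value R)) (v w : value R) (e : exp) (T : nat).

Definition ev env e T v := exists2 t, (t <= T)%N & evals p env e t v.

Lemma ev_le env e T v T' v' : ev env e T v -> (T <= T')%N -> v = v' -> ev env e T' v'.
Proof. by case=> t tT h TT' <-; exists t => //; exact: leq_trans TT'. Qed.

Lemma ev_var env i v : (i < size env)%N -> v = nth VNil env i -> ev env (EVar i) 1 v.
Proof. by move=> h ->; exists 1%N => //; constructor. Qed.

Lemma ev_let env e1 e2 T1 T2 v1 v2 :
  ev env e1 T1 v1 -> ev (v1 :: env) e2 T2 v2 -> ev env (ELet e1 e2) (T1 + T2).+1 v2.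
Proof.
move=> [t1 l1 h1] [t2 l2 h2]; exists (t1 + t2).+1; last exact: eval_let h1 h2.
by rewrite ltnS leq_add.
Qed.

Lemma ev_cst env k : ev env (ECst k) 1 (vnat R k).
Proof. by exists 1%N => //; constructor. Qed.

Lemma ev_arith env o e1 e2 T1 T2 x y :
  ev env e1 T1 (VNum x) -> ev env e2 T2 (VNum y) ->
  ev env (EArith o e1 e2) (T1 + T2).+1 (VNum (arith_fun o x y)).
Proof.
move=> [t1 l1 h1] [t2 l2 h2]; exists (t1 + t2).+1; last exact: eval_arith h1 h2.
by rewrite ltnS leq_add.
Qed.

(* Both branches are evaluated, so that the result is determined without a case
   analysis; recursive calls need [ev_ifle_dec]. *)
Lemma ev_ifle env e1 e2 e3 e4 T1 T2 T3 T4 x y v3 v4 :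
  ev env e1 T1 (VNum x) -> ev env e2 T2 (VNum y) ->
  ev env e3 T3 v3 -> ev env e4 T4 v4 ->
  ev env (EIfLe e1 e2 e3 e4) (T1 + T2 + (T3 + T4)).+1 (if x <= y then v3 else v4).
Proof.
move=> [t1 l1 h1] [t2 l2 h2] [t3 l3 h3] [t4 l4 h4].
exists (t1 + t2 + (if x <= y then t3 else t4)).+1.
  rewrite ltnS !leq_add //; case: ifP => _.
    by rewrite (leq_trans l3) ?leq_addr.
  by rewrite (leq_trans l4) ?leq_addl.
by apply: eval_ifle h1 h2 _; case: ifP.
Qed.

Lemma ev_ifle_dec env e1 e2 e3 e4 T1 T2 T3 x y v :
  ev env e1 T1 (VNum x) -> ev env e2 T2 (VNum y) ->
  ev env (if x <= y then e3 else e4) T3 v ->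
  ev env (EIfLe e1 e2 e3 e4) (T1 + T2 + T3).+1 v.
Proof.
move=> [t1 l1 h1] [t2 l2 h2] [t3 l3 h3].
by exists (t1 + t2 + t3).+1; [rewrite ltnS !leq_add|exact: eval_ifle h1 h2 h3].
Qed.

Lemma ev_nil env : ev env ENil 1 VNil.
Proof. by exists 1%N => //; constructor. Qed.

Lemma ev_pair env e1 e2 T1 T2 v1 v2 :
  ev env e1 T1 v1 -> ev env e2 T2 v2 -> ev env (EPair e1 e2) (T1 + T2).+1 (VPair v1 v2).
Proof.
move=> [t1 l1 h1] [t2 l2 h2]; exists (t1 + t2).+1; last exact: eval_pair h1 h2.
by rewrite ltnS leq_add.
Qed.

Lemma ev_fst env e T v1 v2 : ev env e T (VPair v1 v2) -> ev env (EFst e) T.+1 v1.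
Proof. by move=> [t l h]; exists t.+1 => //; exact: eval_fst h. Qed.

Lemma ev_snd env e T v1 v2 : ev env e T (VPair v1 v2) -> ev env (ESnd e) T.+1 v2.
Proof. by move=> [t l h]; exists t.+1 => //; exact: eval_snd h. Qed.

Lemma ev_ifpair env e1 e2 e3 T1 T2 v1 v :
  ev env e1 T1 v1 -> ev env (if is_pair v1 then e2 else e3) T2 v ->
  ev env (EIfPair e1 e2 e3) (T1 + T2).+1 v.
Proof.
move=> [t1 l1 h1] [t2 l2 h2]; exists (t1 + t2).+1; last exact: eval_ifpair h1 h2.
by rewrite ltnS leq_add.
Qed.

Lemma ev_ifeq env e1 e2 e3 e4 T1 T2 T3 T4 x y v3 v4 :
  ev env e1 T1 (VNum x) -> ev env e2 T2 (VNum y) ->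
  ev env e3 T3 v3 -> ev env e4 T4 v4 ->
  ev env (EIfEq e1 e2 e3 e4) (T1 + T2 + (T2 + T1 + (T3 + T4)).+1).+1
    (if x == y then v3 else v4).
Proof.
move=> h1 h2 h3 h4; apply: (ev_ifle_dec h1 h2); rewrite eq_le.
case: (x <= y); first exact: ev_ifle h2 h1 h3 h4.
by apply: ev_le h4 _ erefl; lia.
Qed.

Definition vbool (c : bool) : value R := if c then VPair VNil VNil else VNil.

Lemma ev_true env : ev env ETrue 3 (vbool true).
Proof. exact: ev_pair (ev_nil _) (ev_nil _). Qed.

Lemma ev_ifbool env e1 e2 e3 T1 T2 T3 c v2 v3 :
  ev env e1 T1 (vbool c) -> ev env e2 T2 v2 -> ev env e3 T3 v3 ->
  ev env (EIfPair e1 e2 e3) (T1 + (T2 + T3)).+1 (if c then v2 else v3).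
Proof.
move=> h1 h2 h3; case: c h1 => h1.
  apply: ev_le (ev_ifpair h1 h2) _ _ => //.
  by rewrite ltnS leq_add2l leq_addr.
by apply: ev_le (ev_ifpair h1 h3) _ _ => //; rewrite ltnS leq_add2l leq_addl.
Qed.

Lemma ev_call env f e T1 T2 a v : (f < size p)%N ->
  ev env e T1 a -> ev [:: a] (nth ENil p f) T2 v ->
  ev env (ECall f e) (T1 + T2).+1 v.
Proof.
move=> fp [t1 l1 h1] [t2 l2 h2]; exists (t1 + t2).+1; last exact: eval_call h1 h2.
by rewrite ltnS leq_add.
Qed.
End Evaluation.

(* The argument of a loop is (context, (list, accumulator)); its step is
   evaluated in the environment [:: accumulator; element; context; argument]. *)
Definition EFold (self : nat) (step : exp) : exp :=
  EIfPair (EFst (ESnd (EVar 0)))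
    (ECall self (EPair (EFst (EVar 0)) (EPair (ESnd (EFst (ESnd (EVar 0))))
      (ELet (EFst (EVar 0)) (ELet (EFst (EFst (ESnd (EVar 1))))
        (ELet (ESnd (ESnd (EVar 2))) step))))))
    (ESnd (ESnd (EVar 0))).

(* Redefined before each lemma to the specifications of the functions called. *)
Ltac ev_call_hook := fail.

Ltac ev_step :=
  lazymatch goal with
  | |- ev _ _ (EVar _) _ _ =>
      eapply ev_var; [exact isT | cbn [nth]; reflexivity]
  | |- ev _ _ (ELet _ _) _ _ => eapply ev_let
  | |- ev _ _ (ECst _) _ _ => eapply ev_cst
  | |- ev _ _ (EArith _ _ _) _ _ => eapply ev_arith
  | |- ev _ _ (EIfLe _ _ _ _) _ _ => eapply ev_ifle
  | |- ev _ _ (EIfEq _ _ _ _) _ _ => eapply ev_ifeq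
  | |- ev _ _ ENil _ _ => eapply ev_nil
  | |- ev _ _ (EPair _ _) _ _ => eapply ev_pair
  | |- ev _ _ ETrue _ _ => eapply ev_true
  | |- ev _ _ (EIfPair _ _ _) _ _ => eapply ev_ifbool
  | |- ev _ _ (EFst _) _ _ => eapply ev_fst
  | |- ev _ _ (ESnd _) _ _ => eapply ev_snd
  | |- ev _ _ (ECall _ _) _ _ => eapply ev_call; [first [exact isT | assumption] | |]
  | |- ev _ _ (nth _ _ _) _ _ => ev_call_hook
  end.

Ltac ev_steps := repeat ev_step.

(** * Loops and coarse time bounds *)

Section Loops.
Variables (R : realType) (p : program) (B : nat).
Hypothesis B_large : (1024 <= B)%N.

(** [acc] is indexed by the processed prefix rather than by a fold state, so that it can depend on
    the position in the list. *)
Lemma ev_fold (A : Type) (encA : A -> value R) self step ctx l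
    (acc : seq A -> value R) T :
  (self < size p)%N -> nth ENil p self = EFold self step ->
  (forall l1 x l2 w, l = l1 ++ x :: l2 ->
    ev p [:: acc l1; encA x; ctx; w] step T (acc (rcons l1 x))) ->
  ev p [:: VPair ctx (VPair (vlist (map encA l)) (acc [::]))] (nth ENil p self)
    ((size l).+1 * (T + 30)) (acc l).
Proof.
move=> sp eself.
suff h l2 l1 : l = l1 ++ l2 -> (forall l1 x l2 w, l = l1 ++ x :: l2 ->
      ev p [:: acc l1; encA x; ctx; w] step T (acc (rcons l1 x))) ->
    ev p [:: VPair ctx (VPair (vlist (map encA l2)) (acc l1))] (nth ENil p self)
    ((size l2).+1 * (T + 30)) (acc l).
  by move=> hs; exact: (h l [::]).
move=> + hs; elim: l2 l1 => [|x l2 IH] l1 el; rewrite eself /EFold.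
  eapply ev_le; [eapply ev_ifpair; [do 3 ev_step|]|..]; first by rewrite /=; do 3 ev_step.
  - by rewrite mul1n; lia.
  - by rewrite el cats0.
have el' : l = rcons l1 x ++ l2 by rewrite cat_rcons.
have hx w := hs l1 x l2 w el.
eapply ev_le; [eapply ev_ifpair; [do 3 ev_step|]|..] => /=.
- repeat (first [exact: hx
    | lazymatch goal with |- ev _ _ (nth _ _ _) _ _ => exact: (IH _ el') end
    | ev_step]).
- by rewrite [X in (_ <= X)%N]mulSn; set Y := (_ * _)%N; lia.
- by [].
Qed.

Lemma pow_absorb c m : (c <= 1000)%N -> (c * B ^ m <= B ^ m.+1)%N.
Proof. by move=> h; rewrite expnS leq_mul2r (leq_trans h) ?orbT // (leq_trans _ B_large). Qed.

(** One factor B pays for the iterations and one for the constants. Since [ev_time] spends another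
    on the body, each level of nesting raises the exponent by 3. *)
Lemma fold_time k m : (k <= B)%N -> (k.+1 * (B ^ m + 30) <= B ^ m.+2)%N.
Proof.
move=> kB; have B0 : (0 < B)%N by apply: leq_trans B_large.
rewrite expnS; apply: (@leq_trans (B.+1 * (31 * B ^ m))).
  apply: leq_mul => //; have : (0 < B ^ m)%N by rewrite expn_gt0 B0.
  by set X := (B ^ m)%N; lia.
apply: (@leq_trans ((B * 2) * (31 * B ^ m))).
  by apply: leq_mul => //; lia.
by rewrite -!mulnA leq_mul2l mulnA pow_absorb // orbT.
Qed.

(** [inv] carries what the time of the step depends on, such as the size of an accumulated table. *)
Lemma ev_foldl (A : eqType) (Acc : Type) (encA : A -> value R) (encAcc : Acc -> value R)
    (F : Acc -> A -> Acc) (inv : Acc -> Prop) self step ctx l z m :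
  (self < size p)%N -> nth ENil p self = EFold self step ->
  (size l <= B)%N -> inv z ->
  (forall a x w, x \in l -> inv a ->
    ev p [:: encAcc a; encA x; ctx; w] step (B ^ m) (encAcc (F a x)) /\ inv (F a x)) ->
  ev p [:: VPair ctx (VPair (vlist (map encA l)) (encAcc z))] (nth ENil p self)
    (B ^ m.+2) (encAcc (foldl F z l)).
Proof.
move=> sp eself lB iz hs.
apply: ev_le (fold_time m lB) erefl.
apply: (ev_fold (acc := fun l1 => encAcc (foldl F z l1)) sp eself).
move=> l1 x l2 w el; rewrite -cats1 foldl_cat /=.
have xl : x \in l by rewrite el mem_cat mem_head orbT.
apply: (hs _ _ w xl _).1; apply: (@foldl_inv _ _ inv) => // y a yl ia.
by apply: (hs a y w _ ia).2; rewrite el mem_cat yl.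
Qed.

Definition tbound m T c := (T <= c * B ^ m)%N.

Lemma tbound1 m : tbound m 1 1.
Proof. by rewrite /tbound mul1n expn_gt0 (leq_trans _ B_large). Qed.

Lemma tboundS m T c : tbound m T c -> tbound m T.+1 c.+1.
Proof.
move=> h; rewrite /tbound mulSn -add1n leq_add //.
by rewrite -[X in (_ <= X)%N]mul1n; exact: tbound1.
Qed.

Lemma tboundD m T1 T2 c1 c2 : tbound m T1 c1 -> tbound m T2 c2 ->
  tbound m (T1 + T2) (c1 + c2).
Proof. by rewrite /tbound mulnDl; apply: leq_add. Qed.

Lemma tboundX m k : (k <= m)%N -> tbound m (B ^ k) 1.
Proof.
move=> km; rewrite /tbound mul1n; apply: leq_pexp2l => //.
exact: leq_trans _ B_large.
Qed.

Lemma tbound_le m T c : tbound m T c -> (c <= 1000)%N -> (T <= B ^ m.+1)%N.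
Proof. by move=> h1 h2; exact: leq_trans h1 (pow_absorb m h2). Qed.
End Loops.

(** The coefficient in [tbound] is an existential variable filled in by the decomposition; in the
    end it only has to be at most 1000. *)
Ltac ev_time :=
  eapply tbound_le; [eassumption | |];
  [repeat lazymatch goal with
   | |- is_true (tbound _ _ (_ + _)%N _) => eapply tboundD
   | |- is_true (tbound _ _ (_ ^ _)%N _) => eapply tboundX; [eassumption | exact isT]
   | |- is_true (tbound _ _ 1%N _) => eapply tbound1; eassumption
   | |- is_true (tbound _ _ _.+1 _) => eapply tboundS; [eassumption |]
   end | exact isT].

(** * The program *)

(* The numbers in [EFold] and [ECall] are positions in [gathering_program]. *)

Section Program.

Local Notation EAdd := (EArith Defs.Add).
Local Notation ESub := (EArith Defs.Sub).
Local Notation x0 := (EVar 0).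
Local Notation x1 := (EVar 1).
Local Notation x2 := (EVar 2).
Local Notation x3 := (EVar 3).
Local Notation x4 := (EVar 4).

(* A site is (index, (snapped root distance, row of distances)); the tokens of
   a state are sites. *)
Local Notation EIdx e := (EFst e) (only parsing).
Local Notation EDt e := (EFst (ESnd e)) (only parsing).
Local Notation ERow e := (ESnd (ESnd e)) (only parsing).
Local Notation EUsers e := (EFst (EFst e)) (only parsing).
Local Notation ESlots e := (ESnd (EFst e)) (only parsing).

Definition f_nth := EIfLe (EFst x0) (ECst 0) (EFst (ESnd x0))
  (ECall 1 (EPair (ESub (EFst x0) (ECst 1)) (ESnd (ESnd x0)))).

Definition f_snap := EFold 2
  (EIfLe (EFst x2) (EAdd (EDt x1) (ESnd x2))
    (EIfLe (EDt x1) (EAdd (EFst x2) (ESnd x2)) (EDt x1) x0) x0).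

(** The accumulator is (next index, earlier sites), the latter being what the new depth is snapped
    against. The head of a row is the distance to the root. *)
Definition f_sites := EFold 3
  (EPair (EAdd (EFst x0) (ECst 1))
    (EPair (EPair (EFst x0)
              (EPair (ECall 2 (EPair (EPair (EFst x1) x2)
                                (EPair (ESnd x0) (EFst x1)))) x1))
       (ESnd x0))).

Definition f_count := EFold 4
  (EIfEq (EDt x1) x2 (EAdd x0 (ECst 1)) x0).

Definition f_sig := EFold 5
  (ELet (EDt x1)
   (EIfEq (ECall 4 (EPair x0 (EPair (EUsers (EFst x3)) (ECst 0))))
          (ECall 4 (EPair x0 (EPair (EUsers (ESnd x3)) (ECst 0))))
   (EIfEq (ECall 4 (EPair x0 (EPair (ESlots (EFst x3)) (ECst 0))))
          (ECall 4 (EPair x0 (EPair (ESlots (ESnd x3)) (ECst 0))))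
     x1 ENil) ENil)).

Definition f_member := EFold 6
  (EIfPair (ECall 5 (EPair (EPair (EFst x2) x1) (EPair (ESnd x2) ETrue)))
     ETrue x0).

Definition f_insert :=
  EIfPair (ECall 6 (EPair (EPair (EFst (ESnd x0)) (EFst x0))
                          (EPair (ESnd (ESnd x0)) ENil)))
    (ESnd (ESnd x0)) (EPair (EFst (ESnd x0)) (ESnd (ESnd x0))).

Definition f_shallow := EFold 8
  (EIfLe (EAdd (EDt x1) (EDt x1)) x2 x0 ENil).

Definition f_catrev := EFold 9 (EPair x1 x0).

Definition f_merge1 := EFold 10
  (ELet (EPair (EPair
     (ECall 9 (EPair ENil (EPair (EUsers (EFst x2)) (EUsers x1))))
     (ECall 9 (EPair ENil (EPair (ESlots (EFst x2)) (ESlots x1)))))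
     (ECall 9 (EPair ENil (EPair (ESnd (EFst x2)) (ESnd x1)))))
   (EIfPair (ECall 8 (EPair (EFst (ESnd x3)) (EPair (EUsers x0) ETrue)))
     (EIfPair (ECall 8 (EPair (EFst (ESnd x3)) (EPair (ESlots x0) ETrue)))
       (ECall 7 (EPair (ESnd (ESnd x3)) (EPair x0 x1))) x1) x1)).

Definition f_merge := EFold 11
  (ECall 10 (EPair (EPair x1 (ESnd x2)) (EPair (EFst x2) x0))).

Definition f_rem := EIfPair (ESnd x0)
  (EIfEq (EFst x0) (EIdx (EFst (ESnd x0)))
    (ESnd (ESnd x0))
    (EPair (EFst (ESnd x0)) (ECall 12 (EPair (EFst x0) (ESnd (ESnd x0))))))
  ENil.

Definition f_slots := EFold 13
  (EIfLe (EAdd (EDt (ESnd (EFst x2))) (EDt x1)) (EFst (ESnd x2))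
    (ECall 7 (EPair (ESnd (ESnd x2))
      (EPair
        (EPair (EPair
           (ECall 12 (EPair (EIdx (ESnd (EFst x2))) (EUsers (EFst (EFst x2)))))
           (ECall 12 (EPair (EIdx x1) (ESlots (EFst (EFst x2))))))
           (EPair (EPair (EIdx (ESnd (EFst x2))) (EIdx x1))
                  (ESnd (EFst (EFst x2)))))
        x0)))
    x0).

Definition f_users := EFold 14
  (ECall 13 (EPair (EPair (EPair (EFst x2) x1) (ESnd x2))
                   (EPair (ESlots (EFst x2)) x0))).

Definition f_match := EFold 15
  (ECall 14 (EPair (EPair x1 x2) (EPair (EUsers x1) x0))).

Definition f_match_all := EFold 16
  (ECall 15 (EPair x2 (EPair x0 x0))).

Definition f_gp :=
  ESub (EAdd (EFst (ERow (EFst x0))) (EFst (ERow (ESnd x0))))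
       (ECall 1 (EPair (EIdx (ESnd x0)) (ERow (EFst x0)))).

Definition f_min_gp := EFold 18
  (ELet (ECall 17 (EPair x2 x1)) (EIfLe x0 x1 x0 x1)).

Definition f_split := EFold 19
  (EIfLe (ECall 17 (EPair (EFst x2) x1)) (ESnd x2)
    (EPair (EFst x0) (EPair x1 (ESnd x0)))
    (EPair (EPair x1 (EFst x0)) (ESnd x0))).

(** The accumulator is (k, (k copies of the site, table for k)). *)
Definition f_fac_table := EFold 20
  (ELet (EAdd (EFst x0) (ECst 1)) (ELet (EPair (EFst x3) (EFst (ESnd x1)))
    (EPair x1 (EPair x0
      (EIfLe (ESnd x4) x1
        (EPair (EPair (EPair ENil x0) ENil) (ESnd (ESnd x2)))
        (ESnd (ESnd x2))))))).

(* The constants passed to the recursion are (b, (delta, (n, (r, sites)))). *)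
Local Notation EB e := (EFst e) (only parsing).
Local Notation EDelta e := (EFst (ESnd e)) (only parsing).
Local Notation ENusers e := (EFst (ESnd (ESnd e))) (only parsing).
Local Notation ERmin e := (EFst (ESnd (ESnd (ESnd e)))) (only parsing).
Local Notation ESites e := (ESnd (ESnd (ESnd (ESnd e)))) (only parsing).

Definition f_single :=
  EIfLe (ENusers (EFst x0)) (EIdx (ESnd x0))
    (ESnd (ESnd (ECall 20
      (EPair (EPair (ESnd x0) (ERmin (EFst x0)))
        (EPair (ESites (EFst x0))
          (EPair (ECst 0) (EPair ENil
            (EPair (EPair (EPair ENil ENil) ENil) ENil))))))))
    (EPair (EPair (EPair (EPair (ESnd x0) ENil) ENil) ENil) ENil).

(** The variables of the innermost body, from 0, are the matching threshold, the two parts, s, the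
    constants, the tail and the head of the cluster. *)
Definition f_solve := EIfPair (ESnd x0) (EIfPair (ESnd (ESnd x0))
  (ELet (EFst (ESnd x0)) (ELet (ESnd (ESnd x1)) (ELet (EFst x2)
  (ELet (ECall 18 (EPair x2 (EPair x1 (EAdd (EFst (ERow x2)) (EFst (ERow x2))))))
  (ELet (ECall 19 (EPair (EPair x3 x0) (EPair x2 (EPair (EPair x3 ENil) ENil))))
  (ELet (EAdd x1 (EAdd (EAdd (EB x2) (EDelta x2)) (EDelta x2)))
    (ECall 16 (EPair (EPair x0 (ESites x3)) (EPair (ESites x3)
      (ECall 11 (EPair (EPair (ECall 22 (EPair x3 (ESnd x1)))
                              (EPair (EAdd x0 (EB x3)) (ESites x3)))
        (EPair (ECall 22 (EPair x3 (EFst x1))) ENil))))))))))))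
  (ECall 21 (EPair (EFst x0) (EFst (ESnd x0))))) ENil.

Definition f_find := EFold 23
  (EIfPair (EUsers x1) x0 (EIfPair (ESlots x1) x0 (EPair ENil (ESnd x1)))).

(* The argument is ((eps, r), (n, (rows, b))). *)
Definition f_attempt :=
  ELet (ESnd (ESnd (ESnd x0)))
  (ELet (EArith Defs.Div (EArith Defs.Mul (EFst (EFst x1)) x0) (ECst 4))
  (ELet (ESnd (ECall 3 (EPair x0 (EPair (EFst (ESnd (ESnd x2)))
                                     (EPair (ECst 0) ENil)))))
  (ECall 23 (EPair ENil (EPair
    (ECall 22 (EPair
       (EPair x2 (EPair x1 (EPair (EFst (ESnd x3)) (EPair (ESnd (EFst x3)) x0))))
       x0))
    ENil))))).

Definition f_row := EFold 25
  (ELet (ECall 24 (EPair (EFst x2) (EPair (EFst (ESnd x2))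
                                     (EPair (ESnd (ESnd x2)) x1))))
  (EIfPair x0
    (EIfPair x1
      (EIfLe x2 (EFst x1) (EPair x2 (ESnd x0)) x1)
      (EPair x2 (ESnd x0)))
    x1)).

Definition f_rows := EFold 26 (ECall 25 (EPair x2 (EPair x1 x0))).

Definition f_length := EFold 27 (EAdd x0 (ECst 1)).

Definition f_lookup := EFold 28 (EIfEq (EFst x1) x2 (ESnd x1) x0).

(** The list of users is only a counter. The index runs downwards so that prepending gives
    increasing order, and n is subtracted because facility f is site n + f. *)
Definition f_assign := EFold 29
  (ELet (ESub (EFst x0) (ECst 1))
    (EPair x0 (EPair (ESub (ECall 28 (EPair x0 (EPair (EFst x3) (ECst 0)))) (ESnd x3))
                     (ESnd x1)))).

Definition f_used := EFold 30 (EIfEq (ESnd x1) x2 ETrue x0).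

Definition f_opened := EFold 31
  (ELet (ESub (EFst x0) (ECst 1))
    (EPair x0 (EIfPair (ECall 30 (EPair (EAdd x0 (ESnd x3)) (EPair (EFst x3) ENil)))
       (EPair x0 (ESnd x1)) (ESnd x1)))).

(** The variables of the final body, from 0, are the best guess with its matching, n, the distance
    rows, the facilities and the users. *)
Definition f_main :=
  ELet (EFst (ESnd (ESnd (ESnd (ESnd x0)))))
  (ELet (EFst (ESnd (ESnd (ESnd (ESnd (ESnd x1))))))
  (ELet (EFst (ESnd (ESnd (ESnd (ESnd (ESnd (ESnd x2)))))))
  (ELet (ECall 27 (EPair ENil (EPair x2 (ECst 0))))
  (ELet (ECall 26 (EPair (EPair (EPair (EFst x4) (EFst (ESnd x4))) (EPair x0 x1))
                    (EPair x1 ENil)))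
  (EIfPair x0
    (EPair
      (ESnd (ECall 31 (EPair (EPair (ESnd x0) x1)
        (EPair x3 (EPair (ECall 27 (EPair ENil (EPair x3 (ECst 0)))) ENil)))))
      (ESnd (ECall 29 (EPair (EPair (ESnd x0) x1)
        (EPair x4 (EPair x1 ENil))))))
    (EPair ENil ENil)))))).

Definition gathering_program : program :=
  [:: f_main; f_nth; f_snap; f_sites; f_count; f_sig; f_member; f_insert;
      f_shallow; f_catrev; f_merge1; f_merge; f_rem; f_slots; f_users; f_match;
      f_match_all; f_gp; f_min_gp; f_split; f_fac_table; f_single; f_solve;
      f_find; f_attempt; f_row; f_rows; f_length; f_lookup; f_assign; f_used;
      f_opened].
End Program.

(** * Specification of the program *)

Local Notation prog := gathering_program.

Section BasicSpecs.
Variables (R : realType) (B : nat).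
Hypothesis B_large : (1024 <= B)%N.
Local Notation ev := (@ev R prog).

Lemma ev_nth (s : seq R) i : (i < size s)%N -> (size s <= B)%N ->
  ev [:: VPair (vnat R i) (vlist (map (@VNum R) s))] (nth ENil prog 1) (B ^ 2)
    (VNum (nth 0 s i)).
Proof.
move=> iS sB.
suff h : ev [:: VPair (vnat R i) (vlist (map (@VNum R) s))] (nth ENil prog 1)
    (i.+1 * 30) (VNum (nth 0 s i)).
  apply: ev_le h _ erefl; rewrite expnS expn1 leq_mul ?(leq_trans iS) //.
  exact: leq_trans _ B_large.
elim: s i iS {sB} => // x s IH [|i] /= iS.
  eapply ev_le; [eapply ev_ifle_dec; [ev_steps|ev_steps|]|..].
  - by rewrite lexx; ev_steps.
  - by [].
  - by [].
eapply ev_le; [eapply ev_ifle_dec; [ev_steps|ev_steps|]|..].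
- rewrite lern0 /=; ev_steps; rewrite [arith_fun _ _ _]/= -natr1 addrK; exact: IH.
- by rewrite mulSn; set Y := (_ * _)%N; lia.
- by [].
Qed.
End BasicSpecs.

Lemma foldl_map (A B C : Type) (f : A -> B) (F : C -> B -> C) z l :
  foldl F z (map f l) = foldl (fun c x => F c (f x)) z l.
Proof. by elim: l z => /=. Qed.

Lemma foldl_flatten (A B : Type) (F : B -> A -> B) z ll :
  foldl F z (flatten ll) = foldl (foldl F) z ll.
Proof. by elim: ll z => //= l ll IH z; rewrite foldl_cat IH. Qed.

Lemma has_foldl (A : Type) (P : pred A) l :
  has P l = foldl (fun a x => if P x then true else a) false l.
Proof.
rewrite -[LHS]orbF; elim: l false => //= x l IH a.
by rewrite -IH; case: (P x); rewrite ?orbT // orbC.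
Qed.

Lemma all_foldl (A : Type) (P : pred A) l :
  all P l = foldl (fun a x => if P x then a else false) true l.
Proof.
rewrite -[LHS]andbT; elim: l true => //= x l IH a.
by rewrite -IH; case: (P x); rewrite ?andbF //= andbC.
Qed.

Section Specs.
Variables (R : realType) (N n r : nat) (d : nat -> nat -> R) (b dlt : R) (B : nat).
Hypothesis B_large : (1024 <= B)%N.
Hypothesis N_gt0 : (0 < N)%N.
Hypothesis N_le_B : (N <= B)%N.
Local Notation ev := (@ev R prog).
Local Notation Dt := (@Dt R d dlt).

Definition vrow i : value R := vlist (map (@VNum R) [seq d i j | j <- iota 0 N]).
Definition vsite i := VPair (vnat R i) (VPair (VNum (Dt i)) (vrow i)).
Definition vsites (l : seq nat) := vlist (map vsite l).
Definition vpair (m : nat * nat) := VPair (vnat R m.1) (vnat R m.2).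
Definition vstate (p : state) :=
  VPair (VPair (vsites p.1.1) (vsites p.1.2)) (vlist (map vpair p.2)).
Definition vtable (T : seq state) := vlist (map vstate T).

Lemma vrowE i : exists w, vrow i = VPair (VNum (root_dist d i)) w.
Proof. by rewrite /vrow; case: N N_gt0 => // k _; eexists. Qed.

Lemma ev_snap x l : (size l <= B)%N ->
  ev [:: VPair (VPair (VNum x) (VNum dlt)) (VPair (vsites l) (VNum x))]
    (nth ENil prog 2) (B ^ 3) (VNum (snap dlt x (map Dt l))).
Proof.
move=> lB; rewrite /snap foldl_map.
apply: (ev_foldl B_large (inv := fun _ => True) (encAcc := @VNum R)) => //.
move=> a i w _ _; split=> //; eapply ev_le; [ev_steps|ev_time|].
by rewrite /=; do ![case: ifP => _].
Qed.

Ltac ev_call_hook ::= eapply ev_snap.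

Lemma ev_sites : 
  ev [:: VPair (VNum dlt) (VPair (vlist (map vrow (iota 0 N))) (VPair (vnat R 0) VNil))]
    (nth ENil prog 3) (B ^ 6) (VPair (vnat R N) (vsites (all_sites N))).
Proof.
have lB : (size (iota 0 N) <= B)%N by rewrite size_iota.
apply: (ev_le _ (fold_time B_large 4 lB) erefl).
pose acc l := VPair (vnat R (size l)) (vsites (rev l)).
have -> : VPair (vnat R N) (vsites (all_sites N)) = acc (iota 0 N).
  by rewrite /acc size_iota.
apply: (@ev_fold R prog B B_large nat vrow 3 _ _ (iota 0 N) acc) => //.
move=> l1 i l2 w e.
have sl : (size l1 < N)%N by rewrite -(size_iota 0 N) e size_cat /= addnS ltnS leq_addr.
(* As a prefix of [iota 0 N], l1 determines the index i and consists of the earlier sites. *)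
have ei : i = size l1.
  have := congr1 (nth 0%N ^~ (size l1)) e.
  by rewrite nth_cat ltnn subnn nth_iota.
have el : l1 = iota 0 (size l1).
  have := congr1 (take (size l1)) e; rewrite take_size_cat //.
  by rewrite take_iota (minn_idPl (ltnW sl)) => /esym.
have [rw erw] := vrowE i.
rewrite erw; eapply ev_le; [ev_steps|ev_time|].
  by rewrite size_rev; exact: leq_trans (ltnW sl) N_le_B.
rewrite /acc size_rcons rev_rcons /vsites /= [vsite i]/vsite erw.
have eil : iota 0 i = l1 by rewrite ei -el.
by rewrite (DtE d dlt i) eil natr1 -ei.
Qed.

Lemma ev_count c l : (size l <= B)%N ->
  ev [:: VPair (VNum (Dt c)) (VPair (vsites l) (vnat R 0))] (nth ENil prog 4) (B ^ 3)
    (vnat R (count_mem (Dt c) (map Dt l))).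
Proof.
move=> lB; rewrite count_map -[count _ _]add0n.
have -> : (0 + count (preim Dt (pred1 (Dt c))) l)%N =
    foldl (fun k j => if Dt j == Dt c then k.+1 else k) 0%N l.
  elim: l 0%N {lB} => [|j l IH] k /=; first by rewrite addn0.
  by rewrite -IH; case: ifP => _; rewrite ?addSnnS // add0n.
apply: (ev_foldl B_large (inv := fun _ => True) (encAcc := @vnat R)) => //.
move=> a i w _ _; split=> //; eapply ev_le; [ev_steps|ev_time|].
by rewrite /=; case: ifP => _ //; rewrite /vnat natr1.
Qed.

Definition fits (p : state) :=
  [/\ all (ltn^~ N) p.1.1, all (ltn^~ N) p.1.2, (size p.1.1 <= B)%N,
      (size p.1.2 <= B)%N & (size p.2 <= B)%N].

(** Tokens are sites, so multisets of snapped depths agree as soon as the multiplicities agree at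
    the depths of all sites. *)
Lemma sig_eqE p q : fits p -> fits q ->
  sig_eq d dlt p q = all (fun c =>
    (count_mem (Dt c) (map Dt p.1.1) == count_mem (Dt c) (map Dt q.1.1)) &&
    (count_mem (Dt c) (map Dt p.1.2) == count_mem (Dt c) (map Dt q.1.2))) (all_sites N).
Proof.
case=> p1 p2 _ _ _ [q1 q2 _ _ _].
apply/andP/allP => [[/permP e1 /permP e2] c _|h].
  by rewrite e1 e2 !eqxx.
have h' l c : all (ltn^~ N) l -> c \in l -> c \in all_sites N.
  by move=> /allP al /al /=; rewrite mem_rev mem_iota.
by split; apply/allP => x; rewrite mem_cat => /orP[] /mapP[c cl ->] /=;
  [have /andP[] := h c (h' _ _ p1 cl)|have /andP[] := h c (h' _ _ q1 cl)|
   have /andP[] := h c (h' _ _ p2 cl)|have /andP[] := h c (h' _ _ q2 cl)].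
Qed.

Ltac ev_call_hook ::= eapply ev_count.

Lemma ev_sig p q : fits p -> fits q ->
  ev [:: VPair (VPair (vstate p) (vstate q)) (VPair (vsites (all_sites N)) (vbool R true))]
    (nth ENil prog 5) (B ^ 6) (vbool R (sig_eq d dlt p q)).
Proof.
move=> fp fq; rewrite sig_eqE //; set h := fun c : nat => _ && _.
have -> : all h (all_sites N) = foldl (fun a c => if h c then a else false) true (all_sites N).
  exact: all_foldl.
apply: (ev_foldl B_large (inv := fun _ => True) (encAcc := vbool R)) => //.
  by rewrite size_rev size_iota.
have [_ _ p1 p2 _] := fp; have [_ _ q1 q2 _] := fq.
move=> a i w _ _; split=> //; eapply ev_le; [ev_steps; assumption|ev_time|].
rewrite /= !eqr_nat /h; case: (_ == _) => //=; case: (_ == _) => //=.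
Qed.

Ltac ev_call_hook ::= eapply ev_sig.

Lemma ev_member p T : fits p -> (forall q, q \in T -> fits q) -> (size T <= B)%N ->
  ev [:: VPair (VPair (vstate p) (vsites (all_sites N))) (VPair (vtable T) (vbool R false))]
    (nth ENil prog 6) (B ^ 9) (vbool R (has (sig_eq d dlt p) T)).
Proof.
move=> fp fT TB.
have -> : has (sig_eq d dlt p) T =
    foldl (fun a q => if sig_eq d dlt p q then true else a) false T.
  exact: has_foldl.
apply: (ev_foldl B_large (inv := fun _ => True) (encAcc := vbool R)) => //.
move=> a q w /fT fq _; split=> //.
eapply ev_le; [ev_steps; assumption|ev_time|].
by case: ifP.
Qed.

Ltac ev_call_hook ::= eapply ev_member.

Lemma ev_insert p T : fits p -> (forall q, q \in T -> fits q) -> (size T <= B)%N ->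
  ev [:: VPair (vsites (all_sites N)) (VPair (vstate p) (vtable T))]
    (nth ENil prog 7) (B ^ 10) (vtable (insert d dlt p T)).
Proof.
move=> fp fT TB; rewrite [nth _ _ _]/= /f_insert.
eapply ev_le; [ev_steps; assumption|ev_time|].
by rewrite /insert; case: ifP.
Qed.

Lemma ev_shallow lim l : (size l <= B)%N ->
  ev [:: VPair (VNum lim) (VPair (vsites l) (vbool R true))] (nth ENil prog 8) (B ^ 3)
    (vbool R (shallow d dlt lim l)).
Proof.
move=> lB.
have -> : shallow d dlt lim l =
    foldl (fun a j => if Dt j + Dt j <= lim then a else false) true l.
  exact: all_foldl.
apply: (ev_foldl B_large (inv := fun _ => True) (encAcc := vbool R)) => //.
move=> a i w _ _; split=> //; eapply ev_le; [ev_steps|ev_time|].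
by rewrite /=; case: ifP.
Qed.

Lemma ev_catrev (A : eqType) (encA : A -> value R) l1 l2 : (size l1 <= B)%N ->
  ev [:: VPair VNil (VPair (vlist (map encA l1)) (vlist (map encA l2)))]
    (nth ENil prog 9) (B ^ 3) (vlist (map encA (catrev l1 l2))).
Proof.
move=> lB.
have -> : catrev l1 l2 = foldl (fun l x => x :: l) l2 l1.
  by elim: l1 l2 {lB} => //= x l IH l2; rewrite IH.
apply: (ev_foldl B_large (inv := fun _ => True) (encAcc := fun l => vlist (map encA l))) => //.
by move=> a i w _ _; split=> //; eapply ev_le; [ev_steps|ev_time|].
Qed.

Lemma ev_rem i l : (i < N)%N -> all (ltn^~ N) l -> (size l <= B)%N ->
  ev [:: VPair (vnat R i) (vsites l)] (nth ENil prog 12) (B ^ 3) (vsites (rem i l)).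
Proof.
move=> iN lN lB.
suff h : ev [:: VPair (vnat R i) (vsites l)] (nth ENil prog 12)
    ((size l).+1 * (B ^ 1 + 30)) (vsites (rem i l)).
  exact: ev_le h (fold_time B_large 1 lB) erefl.
elim: l {lN lB} => [|j l IH].
  eapply ev_le; [eapply ev_ifpair; [ev_steps|]|..].
  - by rewrite /=; ev_steps.
  - by rewrite mul1n; lia.
  - by [].
eapply ev_le; [eapply ev_ifpair; [ev_steps|]|..].
- by rewrite /=; ev_steps; exact: IH.
- by rewrite [X in (_ <= X)%N]mulSn expn1; set Y := (_ * _)%N; lia.
- by rewrite /= eqr_nat eq_sym; case: eqP.
Qed.

Local Notation D := (root_dist d).
Local Notation gp := (gp d).

Hypothesis dlt_ge0 : 0 <= dlt.
Hypothesis dxx : forall i, d i i = 0.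
Hypothesis dC : forall i j, d i j = d j i.
Hypothesis d_triangle : forall k i j, d i j <= d i k + d k j.
Hypothesis gp_ultra : forall i j k, Num.min (gp i j) (gp j k) <= gp i k.
Variable K : nat.
Hypothesis K_window : b + dlt + dlt <= K%:R * dlt.
Hypothesis NN_le_B : (N * N <= B)%N.
Hypothesis table_le_B : ((N * N).+1 ^ (K.+1 + K.+1) <= B)%N.
Local Notation wf_state := (wf_state N n r d b dlt).
Local Notation node_inv := (node_inv N n r d b dlt).
Local Notation table_inv := (table_inv d dlt).

Lemma wf_fits S p : (forall i, i \in S -> (i < N)%N) -> (size S <= N)%N ->
  wf_state S p -> fits p.
Proof.
move=> SN sS [h1 h2 h3 h4 h5].
have s1 : (size (p.1.1 ++ map fst p.2) <= B)%N.
  rewrite (perm_size h1) size_filter (leq_trans (count_size _ _)) //.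
  exact: leq_trans sS N_le_B.
have s2 : (size (p.1.2 ++ map snd p.2) <= B)%N.
  by rewrite (leq_trans h5) // (leq_trans _ NN_le_B) // leq_mul2l sS orbT.
split.
- apply/allP => i ip /=; apply: SN.
  have : i \in [seq i <- S | (i < n)%N] by rewrite -(perm_mem h1) mem_cat ip.
  by rewrite mem_filter => /andP[].
- by apply/allP => i ip /=; apply: SN; have [] := h2 i; rewrite ?mem_cat ?ip.
- by apply: leq_trans s1; rewrite size_cat leq_addr.
- by apply: leq_trans s2; rewrite size_cat leq_addr.
- by apply: leq_trans s1; rewrite size_cat size_map leq_addl.
Qed.

(** * Merging and matching at one cluster *)

Section Node.
Variables (A A' : seq nat) (s : R).
Local Notation S := (A ++ A').
Hypothesis S_lt : forall i, i \in S -> (i < N)%N.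
Hypothesis S_size : (size S <= N)%N.
Hypothesis gpS : forall x y, x \in S -> y \in S -> s <= gp x y.
Local Notation M := (s + (b + dlt + dlt)).
Local Notation lim := (s + (b + dlt + dlt) + b).
Local Notation good := (table_inv (node_inv S lim)).

Lemma good_size T : good T -> (size T <= B)%N.
Proof.
move=> gT; apply: leq_trans table_le_B.
exact: (node_size dlt_ge0 dxx S_lt S_size gpS K_window gT).
Qed.

Lemma good_fits T p : good T -> p \in T -> fits p.
Proof. by move=> [h _] /h[wp _]; exact: wf_fits S_lt S_size wp. Qed.

Lemma A_fits p : wf_state A p -> fits p.
Proof.
apply: wf_fits => [i iA|]; first by apply: S_lt; rewrite mem_cat iA.
by apply: leq_trans S_size; rewrite size_cat leq_addr.
Qed.

Lemma A'_fits p : wf_state A' p -> fits p.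
Proof.
apply: wf_fits => [i iA|]; first by apply: S_lt; rewrite mem_cat iA orbT.
by apply: leq_trans S_size; rewrite size_cat leq_addl.
Qed.

Ltac ev_call_hook ::=
  first [eapply ev_insert | eapply ev_shallow | eapply ev_catrev].

Lemma ev_merge1 p TB T : wf_state A p -> (forall q, q \in TB -> wf_state A' q) ->
  (size TB <= B)%N -> good T ->
  ev [:: VPair (VPair (vstate p) (VPair (VNum lim) (vsites (all_sites N))))
               (VPair (vtable TB) (vtable T))]
    (nth ENil prog 10) (B ^ 13) (vtable (merge1 d dlt lim TB T p)).
Proof.
move=> wp hB sB gT; apply: (ev_foldl B_large (inv := good) (encAcc := vtable)) => //.
move=> T1 q w qT gT1; have wq := hB q qT.
have wpq : wf_state S (app p q) by exact: app_wf.
have [_ _ p1 p2 p3] := A_fits wp; have [_ _ q1 q2 q3] := A'_fits wq.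
have fpq : fits (app p q) by exact: wf_fits S_lt S_size wpq.
have [_ _ s1 s2 _] := fpq.
split; last first.
  by case: ifP => // ok; apply: table_inv_insert.
eapply ev_le.
- eapply (@ev_let _ _ _ _ _ _ _ (vstate (app p q))); first by ev_steps; assumption.
  ev_steps => //; [by move=> t; exact: good_fits gT1|exact: good_size gT1].
- by ev_time.
- by rewrite /st_shallow; do 2!case: (shallow _ _ _ _).
Qed.

Ltac ev_call_hook ::= eapply ev_merge1.

Lemma ev_merge TA TB : (forall p, p \in TA -> wf_state A p) ->
  (forall q, q \in TB -> wf_state A' q) -> (size TA <= B)%N -> (size TB <= B)%N ->
  ev [:: VPair (VPair (vtable TB) (VPair (VNum lim) (vsites (all_sites N))))
               (VPair (vtable TA) VNil)]
    (nth ENil prog 11) (B ^ 16) (vtable (merge d dlt lim TA TB)).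
Proof.
move=> hA hB sA sB.
apply: (ev_foldl B_large (inv := good) (encAcc := vtable) (z := [::])) => //.
move=> T p w pA gT; have wp := hA p pA.
split; last exact: merge1_inv.
by eapply ev_le; [ev_steps; assumption|ev_time|].
Qed.

Lemma match_fits p u f : node_inv S lim p -> u \in p.1.1 -> f \in p.1.2 ->
  Dt u + Dt f <= M -> fits (pair_up p u f).
Proof.
by move=> ip up fp le; have [/(wf_fits S_lt S_size)] := pair_inv dlt_ge0 gpS ip up fp le.
Qed.

Ltac ev_call_hook ::= first [eapply ev_insert | eapply ev_rem].

Lemma ev_slots p u T : node_inv S lim p -> u \in p.1.1 -> good T ->
  ev [:: VPair (VPair (VPair (vstate p) (vsite u)) (VPair (VNum M) (vsites (all_sites N))))
               (VPair (vsites p.1.2) (vtable T))]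
    (nth ENil prog 13) (B ^ 13) (vtable (match_slots d dlt M p T u)).
Proof.
move=> ip up gT; have [wp _] := ip.
have [p1 p2 s1 s2 _] := wf_fits S_lt S_size wp.
have uN := allP p1 u up.
apply: (ev_foldl B_large (inv := good) (encAcc := vtable)) => //.
move=> T1 f w fp gT1; have fN := allP p2 f fp; split; last first.
  case: ifP => le; last by [].
  by apply: table_inv_insert => //; exact: (pair_inv dlt_ge0 gpS ip up fp le).
have [le|gt] := boolP (Dt u + Dt f <= M); last first.
  eapply ev_le; [eapply ev_ifle_dec; [ev_steps|ev_steps|]|..].
  - by rewrite /= (negPf gt); ev_steps.
  - by ev_time.
  - by [].
eapply ev_le; [eapply ev_ifle_dec; [ev_steps|ev_steps|]|..].
- rewrite /= le; eapply ev_call; [by []| |].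
    eapply ev_pair; first by ev_steps.
    eapply (@ev_pair _ _ _ _ _ _ _ (vstate (pair_up p u f))); last by ev_steps.
    by ev_steps.
  eapply ev_insert; [exact: match_fits|by move=> t; exact: good_fits gT1|
    exact: good_size gT1].
- by ev_time.
- by [].
Qed.

Ltac ev_call_hook ::= eapply ev_slots.

Lemma ev_users p T : node_inv S lim p -> good T ->
  ev [:: VPair (VPair (vstate p) (VPair (VNum M) (vsites (all_sites N))))
               (VPair (vsites p.1.1) (vtable T))]
    (nth ENil prog 14) (B ^ 16) (vtable (match_users d dlt M T p)).
Proof.
move=> ip gT; have [wp _] := ip; have [_ _ s1 _ _] := wf_fits S_lt S_size wp.
apply: (ev_foldl B_large (inv := good) (encAcc := vtable)) => //.
move=> T1 u w up gT1; split; last exact: (match_slots_inv dlt_ge0 gpS ip up gT1).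
by eapply ev_le; [ev_steps; assumption|ev_time|].
Qed.

Ltac ev_call_hook ::= eapply ev_users.

Lemma ev_match T : good T ->
  ev [:: VPair (VPair (VNum M) (vsites (all_sites N))) (VPair (vtable T) (vtable T))]
    (nth ENil prog 15) (B ^ 19) (vtable (match_step d dlt M T)).
Proof.
move=> gT; apply: (ev_foldl B_large (inv := good) (encAcc := vtable)) => //.
  exact: good_size gT.
move=> T1 p w /gT.1 ip gT1; split; last exact: (match_users_inv dlt_ge0 gpS ip gT1).
by eapply ev_le; [ev_steps; assumption|ev_time|].
Qed.

Ltac ev_call_hook ::= eapply ev_match.

Lemma ev_match_all T : good T ->
  ev [:: VPair (VPair (VNum M) (vsites (all_sites N))) (VPair (vsites (all_sites N)) (vtable T))]
    (nth ENil prog 16) (B ^ 22) (vtable (match_all N d dlt M T)).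
Proof.
move=> gT; apply: (ev_foldl B_large (inv := good) (encAcc := vtable)) => //.
  by rewrite size_rev size_iota.
move=> T1 p w _ gT1; split; last exact: (match_step_inv dlt_ge0 gpS gT1).
by eapply ev_le; [ev_steps; assumption|ev_time|].
Qed.
End Node.

Lemma ev_fst_row env e T i :
  ev env e T (vrow i) -> ev env (EFst e) T.+1 (VNum (D i)).
Proof. by have [w ->] := vrowE i; exact: ev_fst. Qed.

Ltac ev_call_hook ::= eapply (ev_nth B_large).

Lemma ev_gp x y : (y < N)%N ->
  ev [:: VPair (vsite x) (vsite y)] (nth ENil prog 17) (B ^ 3) (VNum (gp x y)).
Proof.
move=> yN; rewrite [nth _ _ _]/= /f_gp; eapply ev_le.
- eapply ev_arith; [eapply ev_arith; eapply ev_fst_row; ev_steps|ev_steps];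
  by rewrite size_map size_iota.
- by ev_time.
- by rewrite (nth_map 0%N) ?size_iota // nth_iota.
Qed.

Ltac ev_call_hook ::= eapply ev_gp.

Lemma ev_min_gp x l : all (ltn^~ N) l -> (size l <= B)%N ->
  ev [:: VPair (vsite x) (VPair (vsites l) (VNum (D x + D x)))]
    (nth ENil prog 18) (B ^ 6) (VNum (min_gp d x l)).
Proof.
move=> /allP lN lB.
apply: (ev_foldl B_large (inv := fun _ => True) (encAcc := @VNum R)) => //.
move=> a y w /lN /= yN _; split=> //; eapply ev_le; [ev_steps; exact: yN|ev_time|].
by rewrite /=; case: ifP.
Qed.

Lemma ev_split x s l : all (ltn^~ N) l -> (size l <= B)%N ->
  ev [:: VPair (VPair (vsite x) (VNum s))
           (VPair (vsites l) (VPair (VPair (vsite x) VNil) VNil))]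
    (nth ENil prog 19) (B ^ 6)
    (VPair (vsites (split d x s l).1) (vsites (split d x s l).2)).
Proof.
move=> /allP lN lB.
apply: (ev_foldl B_large (inv := fun _ => True) (z := ([:: x], [::]))
  (encAcc := fun AB => VPair (vsites AB.1) (vsites AB.2))) => //.
move=> a y w /lN /= yN _; split=> //; eapply ev_le; [ev_steps; exact: yN|ev_time|].
by rewrite /=; case: ifP.
Qed.

Lemma ev_fac_table i :
  ev [:: VPair (VPair (vsite i) (vnat R r)) (VPair (vsites (all_sites N))
           (VPair (vnat R 0) (VPair VNil
             (VPair (VPair (VPair VNil VNil) VNil) VNil))))]
    (nth ENil prog 20) (B ^ 3)
    (VPair (vnat R N) (VPair (vsites (nseq N i)) (vtable (fac_table r i N)))).
Proof.
pose enc k := VPair (vnat R k) (VPair (vsites (nseq k i)) (vtable (fac_table r i k))).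
have eN : N = foldl (fun k (_ : nat) => k.+1) 0%N (all_sites N).
  rewrite -[LHS](size_iota 0 N) -size_rev -/(all_sites N) -[LHS]addn0.
  by elim: (all_sites N) 0%N => //= _ l IH k; rewrite -IH addnS.
rewrite -/(enc N) [in enc N]eN.
apply: (ev_foldl B_large (inv := fun _ => True) (encAcc := enc)) => //.
  by rewrite size_rev size_iota.
move=> k j w _ _; split=> //; eapply ev_le; [ev_steps|ev_time|].
by rewrite /= natr1 ler_nat /enc /=; case: ifP.
Qed.

Definition vconsts := VPair (VNum b) (VPair (VNum dlt)
  (VPair (vnat R n) (VPair (vnat R r) (vsites (all_sites N))))).

Ltac ev_call_hook ::= eapply ev_fac_table.

Lemma ev_single i : ev [:: VPair vconsts (vsite i)] (nth ENil prog 21) (B ^ 4)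
  (vtable (single N n r i)).
Proof.
rewrite [nth _ _ _]/= /f_single; eapply ev_le; [ev_steps|ev_time|].
by rewrite /= ler_nat /single; case: ifP.
Qed.

(** The recursion is a binary tree whose leaves are the sites of S, hence with 2 |S| - 1 nodes. The
    cost of a node is dominated by [match_all]. *)
Lemma ev_solve k S : cluster N d S -> (0 < size S <= k)%N ->
  ev [:: VPair vconsts (vsites S)] (nth ENil prog 22)
    ((size S).*2.-1 * B ^ 24) (vtable (solve N n r d b dlt k S)).
Proof.
elim: k S => [|k IH] S; first by case: S.
case: S => // x l cS sk.
have [_ SN _] := cS.
rewrite [nth _ _ _]/= /f_solve; case: l => [|y l] in cS SN sk *.
  eapply ev_le; [eapply ev_ifpair; [ev_steps|]|..].
  - rewrite [is_pair _]/=; eapply ev_ifpair; [ev_steps|]; rewrite [is_pair _]/=.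
    eapply ev_call; [by []|by ev_steps|exact: ev_single].
  - by rewrite mul1n; ev_time.
  - by [].
have [[pAB cA cB A0 B0] [hin _]] :=
  split_cluster dxx dC d_triangle gp_ultra (isT : y :: l != [::]) cS.
have lN : all (ltn^~ N) (y :: l).
  by apply/allP => z zl; apply: SN; rewrite inE zl orbT.
have sS := cluster_size cS.
have lB : (size (y :: l) <= B)%N.
  by apply: leq_trans (leq_trans sS N_le_B) => /=.
have := ev_min_gp x lN lB; have := ev_split x (min_gp d x (y :: l)) lN lB.
rewrite [solve _ _ _ _ _ _ _ _]/=.
set s := min_gp d x (y :: l) in pAB cA cB A0 B0 hin *.
set C := (split _ _ _ _).1 in pAB cA A0 *.
set C' := (split _ _ _ _).2 in pAB cB B0 *.
move=> hsplit hmin.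
have sCC : (size C + size C' = (size l).+2)%N by rewrite -size_cat (perm_size pAB).
have Ck : (0 < size C <= k)%N.
  by rewrite A0 -ltnS (leq_trans _ sk) //= -sCC -addn1 leq_add2l.
have C'k : (0 < size C' <= k)%N.
  by rewrite B0 -ltnS (leq_trans _ sk) //= -sCC -add1n leq_add2r.
have [wC tC] := solve_inv n r dlt_ge0 dxx dC d_triangle gp_ultra K_window cA Ck.
have [wC' tC'] := solve_inv n r dlt_ge0 dxx dC d_triangle gp_ultra K_window cB C'k.
have S_lt i : i \in C ++ C' -> (i < N)%N by rewrite (perm_mem pAB); exact: SN.
have S_size : (size (C ++ C') <= N)%N by rewrite (perm_size pAB).
have gpS i j : i \in C ++ C' -> j \in C ++ C' -> s <= gp i j.
  by rewrite !(perm_mem pAB); exact: hin.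
have hmerge := ev_merge S_lt S_size gpS wC wC' (leq_trans tC table_le_B)
  (leq_trans tC' table_le_B).
have hmatch := ev_match_all S_lt S_size gpS (merge_inv _ wC wC').
have hC := IH C cA Ck; have hC' := IH C' cB C'k.
eapply ev_le.
- eapply ev_ifpair; [ev_steps|]; rewrite [is_pair _]/=.
  eapply ev_ifpair; [ev_steps|]; rewrite [is_pair _]/=.
  eapply ev_let; [ev_steps|]; eapply ev_let; [ev_steps|]; eapply ev_let; [ev_steps|].
  eapply (@ev_let _ _ _ _ _ _ _ (VNum s)).
    eapply ev_call; [by []| |exact: hmin].
    eapply ev_pair; [ev_steps|]; eapply ev_pair; [ev_steps|].
    eapply ev_arith; eapply ev_fst_row; ev_steps.
  eapply ev_let.
    by eapply ev_call; [by []| |exact: hsplit]; ev_steps.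
  eapply ev_let; first by ev_steps.
  eapply ev_call; [by []| |exact: hmatch].
  eapply ev_pair; [by ev_steps|]; eapply ev_pair; [by ev_steps|].
  eapply ev_call; [by []| |exact: hmerge].
  eapply ev_pair.
    eapply ev_pair; last by ev_steps.
    eapply ev_call; [by []| |exact: hC']; by ev_steps.
  eapply ev_pair; last by ev_steps.
  eapply ev_call; [by []| |exact: hC]; by ev_steps.
- have -> : ((size [:: x, y & l]).*2.-1 * B ^ 24 =
      (size C).*2.-1 * B ^ 24 + (size C').*2.-1 * B ^ 24 + B ^ 24)%N.
    rewrite -!mulnDl -[X in (_ + X)%N]mul1n -mulnDl; congr (_ * _)%N.
    have -> : size [:: x, y & l] = (size C + size C')%N by rewrite sCC.
    by move: (size C) (size C') A0 B0 => p q; lia.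
  set X1 := ((size C).*2.-1 * _)%N; set X2 := ((size C').*2.-1 * _)%N.
  have h6 : (B ^ 6 <= B ^ 22)%N by rewrite leq_pexp2l // (leq_trans _ B_large).
  have h16 : (B ^ 16 <= B ^ 22)%N by rewrite leq_pexp2l // (leq_trans _ B_large).
  have h1 : (0 < B ^ 22)%N by rewrite expn_gt0 (leq_trans _ B_large).
  have h24 : (1000 * B ^ 22 <= B ^ 24)%N.
    apply: (leq_trans (pow_absorb B_large 22 (leqnn _))).
    by rewrite leq_pexp2l // (leq_trans _ B_large).
  move: X1 X2 (B ^ 6)%N (B ^ 16)%N (B ^ 22)%N (B ^ 24)%N h6 h16 h1 h24.
  by lia.
- by [].
Qed.

Definition vmatching (mt : seq (nat * nat)) := vlist (map vpair mt).

Definition voption (a : option (seq (nat * nat))) :=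
  if a is Some mt then VPair VNil (vmatching mt) else VNil.

Lemma ev_find T : (size T <= B)%N ->
  ev [:: VPair VNil (VPair (vtable T) VNil)] (nth ENil prog 23) (B ^ 3)
    (voption (find_done T)).
Proof.
move=> TB.
apply: (ev_foldl B_large (inv := fun _ => True) (encAcc := voption) (z := None)) => //.
move=> a [[pu ps] m] w _ _; split=> //.
case: pu => [|u pu]; last first.
  eapply ev_le; [eapply ev_ifpair; [ev_steps|]|..]; first by rewrite /=; ev_steps.
    by ev_time.
  by [].
case: ps => [|f ps]; (eapply ev_le; [eapply ev_ifpair; [ev_steps|]|..];
  [rewrite /=; eapply ev_ifpair; [ev_steps|]; rewrite /=; ev_steps|ev_time|]);
  by [].
Qed.

Lemma sites_cluster : cluster N d (all_sites N).
Proof.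
split; first by rewrite rev_uniq iota_uniq.
  by move=> i; rewrite mem_rev mem_iota.
by move=> x y x' x'' _ yN; rewrite mem_rev mem_iota yN.
Qed.

Lemma sites_size : (0 < size (all_sites N) <= N)%N.
Proof. by rewrite size_rev size_iota N_gt0 leqnn. Qed.

Ltac ev_call_hook ::= first [eapply ev_sites | eapply ev_find].

Lemma ev_attempt eps : dlt = eps * b / 4 ->
  ev [:: VPair (VPair (VNum eps) (vnat R r))
           (VPair (vnat R n) (VPair (vlist (map vrow (iota 0 N))) (VNum b)))]
    (nth ENil prog 24) (B ^ 27)
    (voption (find_done (solve N n r d b dlt N (all_sites N)))).
Proof.
move=> edlt; rewrite [nth _ _ _]/= /f_attempt.
have hsolve := ev_solve sites_cluster sites_size.
have [_ sB] := solve_inv n r dlt_ge0 dxx dC d_triangle gp_ultra K_window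
  sites_cluster sites_size.
have time : ((size (all_sites N)).*2.-1 * B ^ 24 <= B ^ 26)%N.
  rewrite size_rev size_iota; apply: (@leq_trans (2 * B * B ^ 24)).
    by rewrite leq_mul2r; apply/orP; right; move: N_le_B; lia.
  by rewrite -mulnA -expnS; exact: (pow_absorb B_large 25 (isT : 2 <= 1000)%N).
have TB := leq_trans sB table_le_B.
eapply ev_le.
- eapply ev_let; first by ev_steps.
  eapply (@ev_let _ _ _ _ _ _ _ (VNum dlt)).
    by eapply ev_le; [ev_steps|exact: leqnn|rewrite edlt].
  eapply ev_let; first by ev_steps.
  eapply ev_call; [by []| |exact: (ev_find TB)].
  eapply ev_pair; first by ev_steps.
  eapply ev_pair; last by ev_steps.
  eapply ev_call; [by []| |exact: ev_le hsolve time erefl]; by ev_steps.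
- by ev_time.
- by [].
Qed.
End Specs.

Lemma ev_length (R : realType) (B : nat) (A : eqType) (encA : A -> value R) (l : seq A) :
  (1024 <= B)%N -> (size l <= B)%N ->
  ev prog [:: VPair VNil (VPair (vlist (map encA l)) (vnat R 0))] (nth ENil prog 27)
    (B ^ 3) (vnat R (size l)).
Proof.
move=> B_large lB.
have -> : size l = foldl (fun k _ => k.+1) 0%N l.
  by rewrite -[LHS]addn0; elim: l 0%N {lB} => //= _ l IH k; rewrite -IH addnS.
apply: (ev_foldl B_large (inv := fun _ => True) (encAcc := @vnat R)) => //.
move=> k x w _ _; split=> //; eapply ev_le; [ev_steps|ev_time|].
by rewrite /= natr1.
Qed.

(** * Reading the solution off a matching *)

Section Output.
Variables (R : realType) (B n m : nat) (mt : seq (nat * nat)).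
Hypothesis B_large : (1024 <= B)%N.
Hypothesis mt_size : (size mt <= B)%N.
Local Notation ev := (@ev R prog).
Local Notation vmt := (vmatching R mt).

Definition lookup u := foldl (fun f e => if e.1 == u then e.2 else f) 0%N mt.

Definition used f := has (fun e : nat * nat => e.2 == f) mt.

Lemma ev_lookup u :
  ev [:: VPair (vnat R u) (VPair vmt (vnat R 0))] (nth ENil prog 28) (B ^ 3)
    (vnat R (lookup u)).
Proof.
apply: (ev_foldl B_large (inv := fun _ => True) (encAcc := @vnat R)) => //.
move=> f e w _ _; split=> //; eapply ev_le; [ev_steps|ev_time|].
by rewrite /= eqr_nat; case: ifP.
Qed.

Lemma ev_used f :
  ev [:: VPair (vnat R f) (VPair vmt VNil)] (nth ENil prog 30) (B ^ 3)
    (vbool R (used f)).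
Proof.
have -> : used f = foldl (fun a e => if e.2 == f then true else a) false mt.
  exact: has_foldl.
apply: (ev_foldl B_large (inv := fun _ => True) (encAcc := vbool R) (z := false)) => //.
move=> a e w _ _; split=> //; eapply ev_le; [ev_steps|ev_time|].
by rewrite /= eqr_nat; case: ifP.
Qed.

Ltac ev_call_hook ::= eapply ev_lookup.

Definition vassigned l := vlist [seq VNum ((lookup u)%:R - n%:R : R) | u <- l].

Lemma ev_assign (A : Type) (encA : A -> value R) (l : seq A) :
  size l = n -> (n <= B)%N ->
  ev [:: VPair (VPair vmt (vnat R n)) (VPair (vlist (map encA l))
                                         (VPair (vnat R n) VNil))]
    (nth ENil prog 29) (B ^ 6) (VPair (vnat R 0) (vassigned (iota 0 n))).
Proof.
move=> sl nB.
pose acc (l1 : seq A) := VPair (vnat R (n - size l1))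
  (vassigned (iota (n - size l1) (size l1))).
have lB : (size l <= B)%N by rewrite sl.
have -> : VPair (vnat R 0) (vassigned (iota 0 n)) = acc l.
  by rewrite /acc sl subnn.
have -> : VPair (vnat R n) VNil = acc [::] by rewrite /acc subn0.
apply: (ev_le _ (fold_time B_large 4 lB) erefl).
apply: (@ev_fold R prog B B_large A encA 29 _ _ l acc) => //.
move=> l1 x l2 w el.
have l1n : (size l1 < n)%N by rewrite -sl el size_cat /= addnS ltnS leq_addr.
have e : (n - size l1)%:R - 1 = (n - (size l1).+1)%:R :> R.
  by rewrite subnS -[in LHS](prednK (n := n - size l1)) ?subn_gt0 // -natr1 addrK.
eapply ev_le.
- eapply (@ev_let _ _ _ _ _ _ _ (vnat R (n - (size l1).+1))).
    by eapply ev_le; [ev_steps|exact: leqnn|rewrite /= e].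
  by ev_steps.
- by ev_time.
- rewrite /acc size_rcons /=; congr (VPair _ (VPair _ _)).
  by rewrite subnSK.
Qed.

Ltac ev_call_hook ::= eapply ev_used.

Definition vopened l := vlist [seq vnat R f | f <- l & used (f + n)].

Lemma ev_opened (A : Type) (encA : A -> value R) (l : seq A) :
  size l = m -> (m <= B)%N ->
  ev [:: VPair (VPair vmt (vnat R n)) (VPair (vlist (map encA l))
                                         (VPair (vnat R m) VNil))]
    (nth ENil prog 31) (B ^ 6) (VPair (vnat R 0) (vopened (iota 0 m))).
Proof.
move=> sl nB.
pose acc (l1 : seq A) := VPair (vnat R (m - size l1))
  (vopened (iota (m - size l1) (size l1))).
have lB : (size l <= B)%N by rewrite sl.
have -> : VPair (vnat R 0) (vopened (iota 0 m)) = acc l.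
  by rewrite /acc sl subnn.
have -> : VPair (vnat R m) VNil = acc [::] by rewrite /acc subn0.
apply: (ev_le _ (fold_time B_large 4 lB) erefl).
apply: (@ev_fold R prog B B_large A encA 31 _ _ l acc) => //.
move=> l1 x l2 w el.
have l1m : (size l1 < m)%N by rewrite -sl el size_cat /= addnS ltnS leq_addr.
have e : (m - size l1)%:R - 1 = (m - (size l1).+1)%:R :> R.
  by rewrite subnS -[in LHS](prednK (n := m - size l1)) ?subn_gt0 // -natr1 addrK.
eapply ev_le.
- eapply (@ev_let _ _ _ _ _ _ _ (vnat R (m - (size l1).+1))).
    by eapply ev_le; [ev_steps|exact: leqnn|rewrite /= e].
  eapply ev_pair; first by ev_steps.
  eapply ev_ifbool; [|by ev_steps|by ev_steps].
  eapply ev_call; [by []| |exact: (ev_used (m - (size l1).+1 + n))].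
  by eapply ev_le; [ev_steps|exact: leqnn|rewrite /= -natrD].
- by ev_time.
- rewrite /acc size_rcons /= /vopened /=; congr (VPair _ _).
  by rewrite subnSK //; case: ifP.
Qed.
End Output.

(** * Search over the guesses for the optimum *)

Section Search.
Variables (R : realType) (N n m r : nat) (d : nat -> nat -> R) (eps : R) (B K : nat).
Hypothesis B_large : (1024 <= B)%N.
Hypothesis N_le_B : (N <= B)%N.
Hypothesis NN_le_B : (N * N <= B)%N.
Hypothesis table_le_B : ((N * N).+1 ^ (K.+1 + K.+1) <= B)%N.
Hypothesis N_split : N = (n + m)%N.
Hypothesis eps_gt0 : 0 < eps.
Hypothesis K_eps : 4 / eps + 2 <= K%:R.
Hypothesis d_ge0 : forall i j, 0 <= d i j.
Hypothesis dxx : forall i, d i i = 0.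
Hypothesis dC : forall i j, d i j = d j i.
Hypothesis d_triangle : forall k i j, d i j <= d i k + d k j.
Hypothesis gp_ultra : forall i j k, Num.min (gp d i j) (gp d j k) <= gp d i k.
Local Notation ev := (@ev R prog).
Local Notation row i := [seq d i j | j <- iota 0 N].

(** Four snapping errors of this size make eps b. *)
Definition grid b := eps * b / 4.

Definition attempt b := find_done (solve N n r d b (grid b) N (all_sites N)).

Definition improve (a : option (R * seq (nat * nat))) b :=
  if attempt b is Some mt then
    if a is Some bm then if b <= bm.1 then Some (b, mt) else a else Some (b, mt)
  else a.

Definition best := foldl improve None (flatten [seq row i | i <- iota 0 N]).

Lemma grid_window b : 0 <= b -> b + grid b + grid b <= K%:R * grid b.
Proof.
move=> b0; have eps0 := eps_gt0; have hK := K_eps.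
have g0 : 0 <= grid b by rewrite /grid divr_ge0 // mulr_ge0 // ltW.
have eb : b = 4 / eps * grid b by rewrite /grid; field; rewrite gt_eqF.
rewrite {1}eb; apply: le_trans (ler_wpM2r g0 hK); rewrite mulrDl; lra.
Qed.

Lemma attemptP b mt : 0 <= b -> attempt b = Some mt ->
  wf_state N n r d b (grid b) (all_sites N) ([::], [::], mt).
Proof.
move=> b0; have eps0 := eps_gt0.
have g0 : 0 <= grid b by rewrite /grid divr_ge0 // mulr_ge0 // ltW.
rewrite /attempt; case: (posnP N) => [->//|N0].
have [wf _] := solve_inv n r g0 dxx dC d_triangle gp_ultra (grid_window b0)
  (sites_cluster N d) (sites_size N0).
by move=> /find_doneP/wf.
Qed.

(** All distances are tried and the least successful one is kept, so one success at the optimum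
    bounds the result. *)
Lemma best_spec :
  (forall b mt, best = Some (b, mt) ->
    (exists i j, b = d i j) /\ attempt b = Some mt) /\
  (forall i j, (i < N)%N -> (j < N)%N -> attempt (d i j) != None ->
    exists b mt, best = Some (b, mt) /\ b <= d i j).
Proof.
have h l : (forall b mt, foldl improve None l = Some (b, mt) ->
      b \in l /\ attempt b = Some mt) /\
    (forall b, b \in l -> attempt b != None ->
      exists b' mt, foldl improve None l = Some (b', mt) /\ b' <= b).
  elim/last_ind: l => [|l c [IH1 IH2]]; first by [].
  rewrite -cats1 foldl_cat /= {1 3}/improve; split=> [b mt|b].
    rewrite mem_cat mem_seq1; case ec: (attempt c) => [mt'|]; last first.
      by move=> /IH1[-> ->].
    case e: (foldl _ _ _) => [[b' mt'']|].
      case: ifP => _ [<- <-]; first by rewrite eqxx orbT.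
      by have [-> ->] := IH1 _ _ e.
    by case=> <- <-; rewrite eqxx orbT.
  rewrite mem_cat mem_seq1 => hb ab; case ec: (attempt c) => [mt'|]; last first.
    apply: IH2 => //; case/orP: hb => // /eqP ebc.
    by rewrite ebc ec in ab.
  case/orP: hb => [/IH2/(_ ab)[b' [mt [-> le]]] /=|/eqP->].
    case: ifP => [le'|_]; last by exists b', mt.
    by exists c, mt'; rewrite (le_trans le').
  case e: (foldl _ _ _) => [[b' mt'']|]; last by exists c, mt'.
  case: ifPn => /= [_|]; first by exists c, mt'.
  by rewrite -ltNge => /ltW ?; exists b', mt''.
have [h1 h2] := h (flatten [seq row i | i <- iota 0 N]); split.
  move=> b mt /h1[/flatten_mapP[i _ /mapP[j _ ->]] ?]; split=> //.
  by exists i, j.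
move=> i j iN jN; apply: h2; apply/flatten_mapP; exists i; rewrite ?mem_iota //.
by apply: map_f; rewrite mem_iota.
Qed.

Definition vbest (a : option (R * seq (nat * nat))) :=
  if a is Some bm then VPair (VNum bm.1) (vmatching R bm.2) else VNil.

Definition vquery := VPair (VPair (VNum eps) (vnat R r))
  (VPair (vnat R n) (vlist (map (vrow N d) (iota 0 N)))).

Lemma ev_attempt_grid b : (0 < N)%N -> 0 <= b ->
  ev [:: VPair (VPair (VNum eps) (vnat R r))
           (VPair (vnat R n) (VPair (vlist (map (vrow N d) (iota 0 N))) (VNum b)))]
    (nth ENil prog 24) (B ^ 27) (voption R (attempt b)).
Proof.
move=> N0 b0; have eps0 := eps_gt0.
have g0 : 0 <= grid b by rewrite /grid divr_ge0 // mulr_ge0 // ltW.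
exact: (ev_attempt n r B_large N0 N_le_B g0 dxx dC d_triangle gp_ultra
  (grid_window b0) NN_le_B table_le_B erefl).
Qed.

Lemma ev_row i a : (0 < N)%N ->
  ev [:: VPair vquery (VPair (vrow N d i) (vbest a))]
    (nth ENil prog 25) (B ^ 30) (vbest (foldl improve a (row i))).
Proof.
move=> N0; apply: (ev_foldl B_large (inv := fun _ => True) (encAcc := vbest)) => //.
  by rewrite size_map size_iota.
move=> {}a b w /mapP[j _ ->] _; split=> //; rewrite /improve.
have h := ev_attempt_grid N0 (d_ge0 i j).
case: (attempt _) h => [mt|] h; last first.
  eapply ev_le; [eapply ev_let|..].
  - by eapply ev_call; [by []| |exact: h]; ev_steps.
  - by eapply ev_ifpair; [ev_steps|]; rewrite /=; ev_steps.
  - by ev_time.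
  - by [].
case: a => [[b' mt']|].
  eapply ev_le; [eapply ev_let|..].
  - by eapply ev_call; [by []| |exact: h]; ev_steps.
  - eapply ev_ifpair; [ev_steps|]; rewrite /=.
    by eapply ev_ifpair; [ev_steps|]; rewrite /=; ev_steps.
  - by ev_time.
  - by rewrite /=; case: ifP.
eapply ev_le; [eapply ev_let|..].
- by eapply ev_call; [by []| |exact: h]; ev_steps.
- eapply ev_ifpair; [ev_steps|]; rewrite /=.
  by eapply ev_ifpair; [ev_steps|]; rewrite /=; ev_steps.
- by ev_time.
- by [].
Qed.

Lemma ev_best :
  ev [:: VPair vquery (VPair (vlist (map (vrow N d) (iota 0 N))) VNil)]
    (nth ENil prog 26) (B ^ 33) (vbest best).
Proof.
have -> : best = foldl (fun a i => foldl improve a (row i)) None (iota 0 N).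
  by rewrite /best foldl_flatten foldl_map.
apply: (ev_foldl B_large (inv := fun _ => True) (encAcc := vbest) (z := None)) => //.
  by rewrite size_iota.
move=> a i w iN _; split=> //.
have N0 : (0 < N)%N by move: iN; rewrite mem_iota; case: (N).
eapply ev_le.
- by eapply ev_call; [by []| |exact: (ev_row i a N0)]; ev_steps.
- by ev_time.
- by [].
Qed.

Definition voutput :=
  if best is Some bm then
    VPair (vopened R n bm.2 (iota 0 m)) (vassigned R n bm.2 (iota 0 n))
  else VPair VNil VNil.

Lemma ev_main (A A' : eqType) (encA : A -> value R) (encA' : A' -> value R)
    (us : seq A) (fs : seq A') w w' :
  size us = n -> size fs = m ->
  ev [:: vlist [:: VNum eps; vnat R r; w; w'; vlist (map encA us);
           vlist (map encA' fs); vlist (map (vrow N d) (iota 0 N))]]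
    (nth ENil prog 0) (B ^ 34) voutput.
Proof.
move=> su sf; rewrite [nth _ _ _]/= /f_main.
have nB : (n <= B)%N by apply: leq_trans N_le_B; rewrite N_split leq_addr.
have mB : (m <= B)%N by apply: leq_trans N_le_B; rewrite N_split leq_addl.
have hn : ev [:: VPair VNil (VPair (vlist (map encA us)) (vnat R 0))]
    (nth ENil prog 27) (B ^ 3) (vnat R n).
  by have := @ev_length R B A encA us B_large; rewrite su; apply.
have hm : ev [:: VPair VNil (VPair (vlist (map encA' fs)) (vnat R 0))]
    (nth ENil prog 27) (B ^ 3) (vnat R m).
  by have := @ev_length R B A' encA' fs B_large; rewrite sf; apply.
have hbest := ev_best.
rewrite /voutput; case e: best hbest => [[b mt]|] hbest.
  have [_ amt] := best_spec.1 _ _ e.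
  have mtB : (size mt <= B)%N.
    have [i [j eb]] := (best_spec.1 _ _ e).1.
    have b0 : 0 <= b by rewrite eb.
    have [_ SN _] := sites_cluster N d.
    have sS : (size (all_sites N) <= N)%N by rewrite size_rev size_iota.
    by have [_ _ _ _] := wf_fits N_le_B NN_le_B SN sS (attemptP b0 amt).
  have hop := @ev_opened R B n m mt B_large mtB A' encA' fs sf mB.
  have has := @ev_assign R B n mt B_large mtB A encA us su nB.
  eapply ev_le.
  - do 3 (eapply ev_let; [by ev_steps|]).
    eapply ev_let; first by eapply ev_call; [by []| |exact: hn]; ev_steps.
    eapply ev_let; first by eapply ev_call; [by []| |exact: hbest]; ev_steps.
    eapply ev_ifpair; [by ev_steps|]; rewrite /=.
    eapply ev_pair.
      eapply ev_snd; eapply ev_call; [by []| |exact: hop].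
      eapply ev_pair; [by ev_steps|]; eapply ev_pair; [by ev_steps|].
      eapply ev_pair; [|by ev_steps].
      by eapply ev_call; [by []| |exact: hm]; ev_steps.
    eapply ev_snd; eapply ev_call; [by []| |exact: has].
    by ev_steps.
  - by ev_time.
  - by [].
eapply ev_le.
- do 3 (eapply ev_let; [by ev_steps|]).
  eapply ev_let; first by eapply ev_call; [by []| |exact: hn]; ev_steps.
  eapply ev_let; first by eapply ev_call; [by []| |exact: hbest]; ev_steps.
  by eapply ev_ifpair; [by ev_steps|]; rewrite /=; ev_steps.
- by ev_time.
- by [].
Qed.
End Search.

(** * From instances to the dynamic program and back *)

Section Lookup.
Variable mt : seq (nat * nat).

Lemma mem_lookup u : u \in map fst mt -> (u, lookup mt u) \in mt.
Proof.
rewrite /lookup; elim/last_ind: mt => // s [u' f] IH.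
rewrite map_rcons !mem_rcons !inE -[in foldl _ _ _]cats1 foldl_cat /= => h.
have [e|ne] := eqVneq u' u; first by rewrite e eqxx.
by move: h; rewrite eq_sym (negPf ne) /= => /IH->; rewrite orbT.
Qed.

Lemma lookup_pair e : uniq (map fst mt) -> e \in mt -> lookup mt e.1 = e.2.
Proof.
case: e => u f umt emt /=; move: (mem_lookup (map_f fst emt)) => /=.
move: (lookup mt u) => g; elim: mt umt emt => //= -[u' f'] s IH /andP[u's us].
have nin t : (u', t) \notin s.
  by apply: contra u's => us'; exact: (map_f fst us').
rewrite !inE !xpair_eqE => h.
case/orP: h => [/andP[/eqP eu /eqP ef]|h].
  by case/orP => [/andP[_ /eqP->]//|]; rewrite eu (negPf (nin _)).
case/orP => [/andP[/eqP eu _]|]; last exact: IH.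
by rewrite eu (negPf (nin _)) in h.
Qed.
End Lookup.

Lemma truncn_ge (R : realType) (x : R) : x <= (Num.truncn x).+1%:R.
Proof.
have [x0|/ltW x0] := leP 0 x; last exact: le_trans x0 (ler0n _ _).
by have /andP[_ /ltW] := truncn_itv x0.
Qed.

Section Reduction.
Variables (R : realType) (I : instance R).
Local Notation n := (nusers I).
Local Notation m := (nfacs I).
Local Notation N := (n + m)%N.

(** Indices from N on get a default vertex, so [site_dist] has the metric properties at all numbers,
    without range conditions. *)
Definition site_vertex i : 'I_(nverts (tree I)) :=
  nth (Ordinal (nverts_gt0 (tree I))) (sites I) i.

Definition site_dist i j : R := dist (site_vertex i) (site_vertex j).

Lemma size_sites : size (sites I) = N.
Proof.
rewrite /sites size_cat size_map size_enum_ord.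
by rewrite [size (map _ _)]size_map size_enum_ord.
Qed.

Lemma site_user (u : 'I_n) : site_vertex u = user u.
Proof.
rewrite /site_vertex nth_cat size_map size_enum_ord ltn_ord.
by rewrite (nth_map u) ?size_enum_ord // nth_ord_enum.
Qed.

Lemma site_fac (f : 'I_m) : site_vertex (n + f) = fac f.
Proof.
rewrite /site_vertex nth_cat size_map size_enum_ord ltnNge leq_addr /= addKn.
by rewrite (nth_map f) ?size_enum_ord // nth_ord_enum.
Qed.

Lemma sitesE : sites I = map site_vertex (iota 0 N).
Proof. by rewrite -size_sites; exact/esym/mkseq_nth. Qed.

Lemma site_gp_ultra i j k :
  Num.min (gp site_dist i j) (gp site_dist j k) <= gp site_dist i k.
Proof.
rewrite /gp /root_dist /site_dist !(distC _ (site_vertex 0)).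
exact: dist_four_point.
Qed.

Lemma vdistsE : venc_dists I = vlist (map (vrow N site_dist) (iota 0 N)).
Proof.
rewrite /venc_dists sitesE -map_comp; congr vlist; apply: eq_map => i /=.
by rewrite /vrow -!map_comp; congr vlist; apply: eq_map.
Qed.

Section Target.
Variable s0 : solution I.
Hypothesis s0_ok : feasible s0.

Definition tgt u := if insub u is Some u' then (n + assign s0 u')%N else 0%N.

Lemma tgtE (u : 'I_n) : tgt u = (n + assign s0 u)%N.
Proof. by rewrite /tgt valK. Qed.

Lemma tgt_fac u : (u < n)%N -> (n <= tgt u < N)%N.
Proof. by move=> un; rewrite (tgtE (Ordinal un)) leq_addr ltn_add2l ltn_ord. Qed.

Lemma dist_le_cost (s : solution I) u : dist (user u) (fac (assign s u)) <= cost s.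
Proof. exact: (le_bigmax _ (fun u => dist (user u) (fac (assign s u)))). Qed.

Lemma tgt_near u : (u < n)%N -> site_dist u (tgt u) <= cost s0.
Proof.
move=> un; rewrite (tgtE (Ordinal un)) /site_dist site_fac.
by rewrite (site_user (Ordinal un)); exact: dist_le_cost.
Qed.

Lemma count_iota_ord (P : pred nat) k :
  count P (iota 0 k) = #|[pred i : 'I_k | P i]|.
Proof. by rewrite -val_enum_ord count_map -size_filter enumT cardE. Qed.

Lemma tgt_load f : count (fun u => tgt u == f) (iota 0 n) = 0%N \/
  (rmin I <= count (fun u => tgt u == f) (iota 0 n))%N.
Proof.
rewrite count_iota_ord; set P := [pred i : 'I_n | _].
have [|/card_gt0P[u]] := posnP #|P|; first by left.
rewrite inE tgtE => /eqP ef; right; have [h1 h2] := s0_ok.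
apply: leq_trans (h2 _ (h1 u)) _; apply/subset_leq_card/fintype.subsetP => v.
by rewrite !inE tgtE -ef eqn_add2l => /eqP->.
Qed.

(** This puts the optimum among the guesses. If the maximum is its default 0, all distances are 0
    and any user attains it. *)
Lemma cost_attained : (0 < n)%N ->
  exists u : 'I_n, cost s0 = site_dist u (n + assign s0 u)%N.
Proof.
move=> n0; pose F (u : 'I_n) := dist (user u) (fac (assign s0 u)).
have eF (u : 'I_n) : site_dist u (n + assign s0 u)%N = F u.
  by rewrite /site_dist site_user site_fac.
have [|[u e]] : cost s0 = 0 \/ exists u : 'I_n, cost s0 = F u.
- rewrite /cost.
  apply: (big_ind (fun x => x = 0 \/ exists u : 'I_n, x = F u)); first by left.
    by move=> x y; rewrite maxEle; case: ifP.
  by move=> u _; right; exists u.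
- move=> c0; exists (Ordinal n0) => //; rewrite eF c0; apply/eqP.
  by rewrite eq_le dist_ge0 /= -c0 dist_le_cost.
- by exists u; rewrite ?eF.
Qed.
End Target.

Lemma matching_solution (s0 : solution I) b dlt mt : 0 <= b -> 0 <= dlt ->
  wf_state N n (rmin I) site_dist b dlt (all_sites N) ([::], [::], mt) ->
  exists s : solution I,
    [/\ VPair (vopened R n mt (iota 0 m)) (vassigned R n mt (iota 0 n)) =
          venc_solution s,
        feasible s & cost s <= b + dlt + dlt + dlt + dlt].
Proof.
move=> b0 dlt0 [/= h1 h2 h3 h4 _].
have pu : perm_eq (map fst mt) (iota 0 n).
  rewrite (perm_trans h1) // uniq_perm ?filter_uniq ?rev_uniq ?iota_uniq //.
  move=> i; rewrite mem_filter mem_rev !mem_iota /= add0n.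
  by case: ltnP => //= h; rewrite (leq_trans h) ?leq_addr.
have umt : uniq (map fst mt) by rewrite (perm_uniq pu) iota_uniq.
have lk (u : 'I_n) : (nat_of_ord u, lookup mt u) \in mt.
  by apply: mem_lookup; rewrite (perm_mem pu) mem_iota add0n ltn_ord.
have lkr (u : 'I_n) : (n <= lookup mt u < N)%N.
  have [] := h2 _ (map_f snd (lk u)).
  by rewrite mem_rev mem_iota add0n /= => -> ->.
pose s := Solution [set f : 'I_m | used mt (f + n)%N]
  (* [insubd] wants some facility as default; by [lkr] the number is always in range. *)
  [ffun u => insubd (assign s0 u) (lookup mt u - n)%N].
have sE (u : 'I_n) : assign s u = (lookup mt u - n)%N :> nat.
  rewrite ffunE val_insubd; have /andP[h h'] := lkr u.
  by rewrite ltn_subLR ?h'.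
have sEn (u : 'I_n) : (assign s u + n)%N = lookup mt u.
  by rewrite sE subnK //; have /andP[] := lkr u.
exists s; split.
- congr VPair; congr vlist.
    rewrite -val_enum_ord filter_map -map_comp enumT [enum (opened _)]/enum_mem.
    by congr map; apply: eq_filter => f /=; rewrite inE.
  rewrite -val_enum_ord -map_comp; apply: eq_map => u /=.
  by rewrite /vnat sE natrB //; have /andP[] := lkr u.
- split=> [u|f].
    by rewrite inE sEn; apply/hasP; exists (nat_of_ord u, lookup mt u) => /=.
  rewrite inE => /hasP[e emt ef].
  (* An opened facility occurs in the matching, so its slot count is not 0 and is at least r. No
     slot is pending, so this count is the number of users assigned to it. *)
  have [h0|hr] := h3 (f + n)%N.
    move: h0 => /eqP; rewrite -leqn0 leqNgt -has_count => /negP[].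
    by apply/hasP; exists e.2; [exact: map_f|exact: ef].
  apply: leq_trans hr _.
  rewrite count_map (eq_in_count (a2 := preim fst (fun u => lookup mt u == f + n)%N)).
    rewrite -count_map (permP pu) count_iota_ord.
    apply/subset_leq_card/fintype.subsetP => u.
    by rewrite !inE -(sEn u) eqn_add2r.
  by move=> x xmt /=; rewrite lookup_pair.
- apply: bigmax_le => [|u _]; first by rewrite !addr_ge0.
  have := h4 _ (lk u); rewrite /= -sEn addnC /site_dist site_fac site_user //.
Qed.
End Reduction.

(** A natural number above 4 / eps + 2, the length of the window of pending depths in units of
    delta. *)
Definition window_size (R : realType) (eps : R) := (Num.truncn (4 / eps)).+3.

(* The exponent makes room for [1024], for the tables of size
   [(k ^ 2 + 1) ^ (2 K + 2)], and for all other lists. *)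
Definition size_bound (R : realType) (eps : R) (k : nat) :=
  (maxn 2 k ^ (10 + 6 * (window_size eps).+1))%N.

Lemma size_boundP (R : realType) (eps : R) k (B := size_bound eps k)
    (K := window_size eps) :
  [/\ (1024 <= B)%N, (k <= B)%N, (k * k <= B)%N &
      ((k * k).+1 ^ (K.+1 + K.+1) <= B)%N].
Proof.
rewrite /B /size_bound -/K; set M := maxn 2 k.
have M2 : (2 <= M)%N by rewrite leq_maxl.
have M0 : (0 < M)%N by apply: leq_trans M2.
have kM : (k <= M)%N by rewrite leq_maxr.
have MX i : (i <= 10 + 6 * K.+1)%N -> (M ^ i <= M ^ (10 + 6 * K.+1))%N.
  by move=> h; rewrite leq_pexp2l.
have kk : (k * k <= M ^ 2)%N by rewrite -mulnn leq_mul.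
split.
- by apply: leq_trans (MX 10%N _); [rewrite (leq_exp2r 2 M (isT : 0 < 10)%N)|lia].
- by apply: leq_trans (MX 1%N _); [rewrite expn1|lia].
- by apply: leq_trans (MX 2%N _); [|lia].
(* As M is at least 2, k ^ 2 + 1 is at most 2 M ^ 2, hence at most M ^ 3. *)
apply: (@leq_trans ((M ^ 3) ^ (K.+1 + K.+1))); last by rewrite -expnM; apply: MX; lia.
rewrite leq_exp2r ?addSn //; apply: (@leq_trans (2 * M ^ 2)).
  by rewrite mul2n -addnn -addn1 leq_add // expn_gt0 M0.
by rewrite (expnS M 2) leq_mul2r M2 orbT.
Qed.

(** The main function takes B ^ 34 steps; one more factor B absorbs the initial call. *)
Definition run_exponent (R : realType) (eps : R) : R :=
  ((10 + 6 * (window_size eps).+1) * 35)%:R.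

Lemma run_exponentO (R : realType) :
  (@run_exponent R) =O_ (0^'+) (fun eps : R => eps^-1).
Proof.
(* With t the integer part of 4 / x, the exponent is 210 t + 1190, at most 2030 / x for x at most
   1. *)
apply/eqO_exP; exists 3000%:R; first by rewrite ltr0n.
near=> x.
have x0 : 0 < x by near: x; exact: nbhs_right_gt.
have x1 : x <= 1 by near: x; exact: nbhs_right_le.
have ix : 1 <= x^-1 by rewrite invf_ge1.
have e0 : 0 <= run_exponent x by exact: ler0n.
rewrite (ger0_norm e0) ger0_norm ?invr_ge0 ?(ltW x0) //.
have /truncn_itv/andP[tl _] : 0 <= 4 / x by rewrite divr_ge0 // ltW.
rewrite /run_exponent /window_size; move: (Num.truncn _) tl => t tl.
have -> : ((10 + 6 * t.+4) * 35 = 210 * t + 1190)%N by lia.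
rewrite natrD natrM; move: (x^-1) (t%:R) ix tl => y t' iy ty.
by lra.
Unshelve. all: by end_near.
Qed.

(** * Approximation guarantee and running time *)

Section MainProof.
Variables (R : realType) (eps : R) (I : instance R).
Hypothesis eps_gt0 : 0 < eps.
Local Notation n := (nusers I).
Local Notation m := (nfacs I).
Local Notation N := (n + m)%N.
Local Notation K := (window_size eps).
Local Notation B := (size_bound eps N).
Local Notation d := (@site_dist R I).
Local Notation r := (rmin I).

Lemma window_size_ge : 4 / eps + 2 <= K%:R.
Proof.
have -> : K = ((Num.truncn (4 / eps)).+1 + 2)%N by rewrite addn2.
by rewrite natrD lerD2r truncn_ge.
Qed.

Let d_ge0 i j : 0 <= d i j. Proof. exact: dist_ge0. Qed.
Let dxx i : d i i = 0. Proof. exact: dist0. Qed.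
Let dC i j : d i j = d j i. Proof. exact: distC. Qed.
Let d_triangle k i j : d i j <= d i k + d k j. Proof. exact: dist_triangle. Qed.
Let d_ultra := @site_gp_ultra R I.

Lemma run_gathering :
  ev prog [:: venc_input eps I] (nth ENil prog 0) (B ^ 34) (voutput N n m r d eps).
Proof.
have [B1 B2 B3 B4] := size_boundP eps N.
rewrite /venc_input vdistsE.
apply: (@ev_main R N n m r d eps B K B1 B2 B3 B4 erefl eps_gt0 window_size_ge
  d_ge0 dxx dC d_triangle d_ultra); exact: size_enum_ord.
Qed.

Let grid_ge0 b : 0 <= b -> 0 <= grid eps b.
Proof. by move=> b0; rewrite /grid divr_ge0 // mulr_ge0 // ltW. Qed.

Lemma best_solution (s0 : solution I) b mt : best N n r d eps = Some (b, mt) ->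
  exists s : solution I, [/\ voutput N n m r d eps = venc_solution s, feasible s &
    cost s <= (1 + eps) * b].
Proof.
move=> eb; have [[i [j ebd]] ab] := (best_spec N n r d eps).1 _ _ eb.
have b0 : 0 <= b by rewrite ebd.
have wf := attemptP eps_gt0 window_size_ge dxx dC d_triangle d_ultra b0 ab.
have [s [es fs cs]] := matching_solution s0 b0 (grid_ge0 b0) wf.
exists s; split=> //; first by rewrite /voutput eb.
by apply: le_trans cs _; rewrite /grid; lra.
Qed.

(** The cost of [s0] is itself a guess, and completeness makes the attempt at it succeed. *)
Lemma best_exists (s0 : solution I) : feasible s0 -> (0 < n)%N ->
  exists b mt, best N n r d eps = Some (b, mt) /\ b <= cost s0.
Proof.
move=> ok0 n0; have N0 : (0 < N)%N by rewrite addn_gt0 n0.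
have c0 : 0 <= cost s0.
  by apply: le_trans (dist_ge0 _ _) (dist_le_cost s0 (Ordinal n0)).
have [u eu] := cost_attained s0 n0; rewrite eu.
apply: (best_spec N n r d eps).2; rewrite -?eu.
- by rewrite ltn_addr.
- by rewrite ltn_add2l.
apply: (@solve_done R N n r d (cost s0) (grid eps (cost s0)) c0 (grid_ge0 c0)
  (rmin_gt0 I) (leq_addr _ _) dxx dC d_triangle d_ultra (tgt s0)).
- exact: tgt_fac.
- exact: tgt_near.
- exact: tgt_load.
- exact: sites_cluster.
- exact: sites_size.
Qed.

Lemma output_correct opt : is_OPT I opt ->
  exists s : solution I, [/\ voutput N n m r d eps = venc_solution s, feasible s &
    cost s <= (1 + eps) * opt].
Proof.
case=> -[s0 [ok0 <-]] _; have e0 : 0 <= 1 + eps by rewrite addr_ge0 // ltW.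
(* Without users all costs are 0, and there may be no distance to guess. *)
case: (posnP n) => [nz|n0]; last first.
  have [b [mt [eb le]]] := best_exists ok0 n0.
  have [s [es fs cs]] := best_solution s0 eb; exists s; split=> //.
  by apply: le_trans cs _; rewrite ler_wpM2l.
have no_user (u : 'I_n) : False by have := ltn_ord u; move: (nat_of_ord u); rewrite nz.
have no_cost (s : solution I) : cost s = 0.
  by rewrite /cost big_pred0 // => u; case: (no_user u).
case eb: (best N n r d eps) => [[b mt]|].
  have [s [es fs cs]] := best_solution s0 eb; exists s; split=> //.
  by rewrite !no_cost mulr0.
(* When no guess succeeds the output is a pair of empty lists; without users it encodes the solution
   that opens nothing. *)
exists (Solution finset.set0 (assign s0)); split.
- rewrite /voutput eb /venc_solution /= enum_set0; congr VPair.
  by rewrite [enum _]size0nil // size_enum_ord.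
- by split=> [u|f]; [case: (no_user u)|rewrite finset.in_set0].
- by rewrite !no_cost mulr0.
Qed.
End MainProof.

Theorem theorem1 (R : realType) :
  exists (p : program) (expo : R -> R),
    (expo =O_ (0^'+) (fun eps : R => eps^-1)) /\
    forall (eps : R) (I : instance R), 0 < eps ->
      exists (t : nat) (out : value R),
        [/\ runs p (venc_input eps I) t out,
            t%:R <= (maxn 2 (nusers I + nfacs I))%:R `^ expo eps &
            forall opt : R, is_OPT I opt ->
              exists s : solution I,
                [/\ out = venc_solution s, feasible s &
                    cost s <= (1 + eps) * opt]].
Proof.
exists gathering_program, (@run_exponent R); split; first exact: run_exponentO.
move=> eps I eps0.
have [B1 _ _ _] := size_boundP eps (nusers I + nfacs I).
have := ev_call (isT : 0 < size gathering_program)%N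
  (@ev_var R _ [:: venc_input eps I] 0 _ isT erefl) (run_gathering I eps0).
set T := (_ + _).+1; set out := voutput _ _ _ _ _ _ => -[t tT ht].
exists t, out; split=> //; last exact: output_correct.
have TB : (t <= size_bound eps (nusers I + nfacs I) ^ 35)%N.
  apply: leq_trans tT _; rewrite /T; ev_time.
rewrite /run_exponent powR_mulrn ?ler0n // -natrX ler_nat.
by rewrite expnM.
Qed.
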